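(* Let $(X_j)_{j\ge1}$ be a sequence of associated, centered real random variables with finite second order moments, and let $(p(n))_{n\ge1}$ be an arbitrary sequence of non-negative integers. Let $\ell(n)\ge 1$, $m(n)\ge 0$, $r(n)$ be integers with $n=m(n)\ell(n)+r(n)$, $0\le r(n)<\ell(n)$ and $m(n)\to+\infty$. Assume that, as $n\to+\infty$: (L) $\ \ell(n)/n\to0$; (H0) $\ \ell(n)/(s_n')^2\to0$; (Ha) $\ \dfrac{1}{(s_n')^2}\sum_{j=1}^{m(n)}\mathrm{Var}(D_{j,n})\to1$; (Hab) $\ \dfrac{1}{(s_n')^2}\mathrm{Var}\left(\sum_{j=p(n)+m(n)\ell(n)+1}^{p(n)+n}X_j\right)\to0$; (Hb) $\ \sup_{1\le j\le m(n)}\dfrac{1}{(s_n')^2}\mathrm{Var}(D_{j,n})\to0$. Then one has $$\frac{S_n'}{s_n'}\ \text{converges in distribution to}\ \mathcal N(0,1)\quad\text{and}\quad B_n\to0\qquad(n\to+\infty)$$ if and only if for every $\varepsilon>0$, $$\frac{1}{(s_n')^2}\sum_{j=1}^{m(n)}\int_{\{|D_{j,n}|\ge\varepsilon\tau_n'\}}|D_{j,n}|^2\,d\mathbb{P}\longrightarrow0\quad\text{as } n\to+\infty .$$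
   Context: Random variables $X_1,X_2,\dots$ are associated if for every $n$ and all bounded coordinatewise non-decreasing measurable $f,g:\mathbb{R}^n\to\mathbb{R}$, $\mathrm{Cov}(f(X_1,\dots,X_n),g(X_1,\dots,X_n))\ge0$. Notation: $S_n'=\sum_{h=p(n)+1}^{n+p(n)}X_h$, $(s_n')^2=\mathrm{Var}(S_n')$ with $s_n'>0$; the block sums are $$D_{j,n}=\sum_{h=p(n)+(j-1)\ell(n)+1}^{p(n)+j\ell(n)}X_h,\quad 1\le j\le m(n);$$ $(\tau_{j,n}')^2=\mathrm{Var}(D_{j,n})$, $(\tau_n')^2=\sum_{j=1}^{m(n)}(\tau_{j,n}')^2$, and $B_n=\max\{\tau_{j,n}'/\tau_n' : 1\le j\le m(n)\}$ (with $\tau'_{j,n},\tau'_n\ge 0$). *)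

(* Defs.v *)
From HB Require Import structures.
From mathcomp Require Import all_boot all_order all_algebra.
From mathcomp Require Import all_classical all_reals all_analysis.

Set Implicit Arguments.
Unset Strict Implicit.
Unset Printing Implicit Defensive.

Import Order.TTheory GRing.Theory Num.Theory.
Import numFieldNormedType.Exports.

Local Open Scope classical_set_scope.
Local Open Scope ring_scope.

(* Sequences of random variables are indexed from 1, as in X_1, X_2, ...; the
   term X 0 is never used. *)

Definition coordinatewise_nondecreasing (R : realType) (n : nat)
    (f : n.-tuple R -> R) : Prop :=
  forall x y : n.-tuple R,
    (forall i : 'I_n, tnth x i <= tnth y i) -> f x <= f y.

Definition associated (d : measure_display) (T : measurableType d)
    (R : realType) (P : probability T R) (X : nat -> {RV P >-> R}) : Prop :=
  forall (n : nat) (f g : n.-tuple R -> R),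
    measurable_fun [set: n.-tuple R] f ->
    measurable_fun [set: n.-tuple R] g ->
    bounded_fun f -> bounded_fun g ->
    coordinatewise_nondecreasing f -> coordinatewise_nondecreasing g ->
    let X1n := fun t : T => [tuple X i.+1 t | i < n] in
    (0 <= covariance P (f \o X1n) (g \o X1n))%E.

(* Weak convergence of the laws: E[f(Y_n)] --> int f dmu for every bounded
   continuous f.  Y n is meant to be measurable. *)
Definition cvg_in_distribution (d : measure_display) (T : measurableType d)
    (R : realType) (P : probability T R) (Y : nat -> T -> R)
    (mu : probability (measurableTypeR R) R) : Prop :=
  forall f : R -> R, continuous f -> bounded_fun f ->
    'E_P[f \o Y n]%E @[n --> \oo] --> (\int[mu]_x (f x)%:E)%E.

Section block_sums.
Context (d : measure_display) (T : measurableType d) (R : realType).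
Context (P : probability T R) (X : nat -> {RV P >-> R}).

(* X_(a+1) + ... + X_b *)
Definition window_sum (a b : nat) (t : T) : R := \sum_(a.+1 <= h < b.+1) X h t.

Definition Var (Y : T -> R) : R := fine 'V_P[Y]%E.

Variables p l m : nat -> nat.

Definition S' (n : nat) : T -> R := window_sum (p n) (n + p n).

Definition s' (n : nat) : R := Num.sqrt (Var (S' n)).

Definition D (j n : nat) : T -> R :=
  window_sum (p n + j.-1 * l n) (p n + j * l n).

Definition remainder (n : nat) : T -> R :=
  window_sum (p n + m n * l n) (p n + n).

Definition tau'_ (j n : nat) : R := Num.sqrt (Var (D j n)).

Definition tau' (n : nat) : R :=
  Num.sqrt (\sum_(1 <= j < (m n).+1) tau'_ j n ^+ 2).

(* The maximised quantities are non-negative, so starting the maximum at 0 only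
   fixes its value over an empty range. *)
Definition B (n : nat) : R :=
  \big[Num.max/0]_(1 <= j < (m n).+1) (tau'_ j n / tau' n).

End block_sums.

(* Main.v *)
Require Import Defs.
From HB Require Import structures.
From mathcomp Require Import all_boot all_order all_algebra.
From mathcomp Require Import all_classical all_reals all_analysis.
From mathcomp Require Import measurable_realfun ring lra.

(** The theorem is Newman's comparison of associated variables with independent
ones, followed by the Lindeberg-Feller theorem for the independent copies.

For an associated sequence, non-decreasing functionals have nonnegative
covariance ([associated_cov_ge0]). If [f] and [g] are [c]-Lipschitz, then
[c x + f x] and [c x - f x] are non-decreasing, and likewise for [g]; so
[|cov (f A) (g B)| <= c ^+ 2 * cov A B] ([cov_lipschitz_le]). Applied to sines
and cosines, this says that the characteristic function of the sum of the blocks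
differs from the product of the characteristic functions of the blocks by at
most a multiple of the sum of the covariances between distinct blocks
([expect_cos_sum], [expect_sin_sum], [expect_modulus_sum]). All covariances
being nonnegative, that sum is at most the difference between the variance of
the whole window and the sum of the variances of the blocks ([sum_cov_le]), a
negligible fraction of the former because the variance ratio tends to 1. The
remainder has negligible variance, so the window sum and the sum of the blocks
have the same limiting characteristic function ([remainder_negligible]).

Lindeberg's half. A second-order expansion with the tail of each block treated
separately ([expect_cos_dev], [expect_sin_dev]) shows that each block can be
replaced by a normal variable of the same variance at a total cost that tends to
zero; the characteristic function of the normalized window sum then tends to
that of the standard normal law, computed in [normal_cos] and [normal_sin].
Convergence of characteristic functions is turned into convergence in
distribution by [levy_continuity], where bounded second moments give tightness
and Bernstein polynomials in a sine give enough test functions.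

Feller's half. Convergence in distribution gives the limit of the modulus of the
characteristic function. Since the blocks are uniformly small, the modulus of
the product is asymptotically the exponential of minus the sum of
[1 - E cos (t D / s')] over the blocks [D], so that this sum tends to
[t ^+ 2 / 2]. Its gap to the second-order term bounds the Lindeberg sum
([tail_moment_le], [lindeberg_sum_le]).

That [B n] tends to zero is read off the ratios of variances ([B_cvg0]).

Complex numbers are avoided throughout: a characteristic function is the pair
made of the expectations of the cosine and of the sine. *)

Set Implicit Arguments.
Unset Strict Implicit.
Unset Printing Implicit Defensive.

Import Order.TTheory GRing.Theory Num.Theory.
Import numFieldNormedType.Exports.

Local Open Scope classical_set_scope.
Local Open Scope ring_scope.

(** * Elementary inequalities *)

Section elementary.
Context {R : realType}.
Implicit Types x y : R.

(** The Taylor remainders below are bounded through their derivatives; [y] may lie on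
either side of [x]. *)
Lemma mean_value_bound (f df : R -> R) (c : R) x y :
  (forall z : R, is_derive z (1 : R) f (df z)) ->
  (forall z : R, `|z - x| <= `|y - x| -> `|df z| <= c) ->
  `|f y - f x| <= c * `|y - x|.
Proof.
move=> fdf dfc.
have fc : continuous f.
  move=> z; apply: differentiable_continuous; apply/derivable1_diffP.
  by have [] := fdf z.
wlog xy : x y f df fdf dfc fc / x <= y => [hw|].
  have [/hw|/ltW yx] := leP x y; first exact.
  rewrite (_ : f y = (f \o -%R) (- y)); last by rewrite /= opprK.
  rewrite (_ : f x = (f \o -%R) (- x)); last by rewrite /= opprK.
  rewrite (_ : `|y - x| = `|- y - - x|); last by rewrite -normrN; congr `|_|; ring.
  apply: (hw _ _ _ (fun z => - df (- z))) => //.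
  - move=> z.
    have := @is_derive1_comp R f -%R z (df (-z)) (-1) (fdf _) _.
    rewrite mulrN1; apply; exact: is_deriveN.
  - move=> z hz; rewrite normrN; apply: dfc.
    rewrite (_ : - z - x = - (z - - x)) ?normrN; last by ring.
    by rewrite (le_trans hz)// le_eqVlt -normrN; apply/orP; left; apply/eqP; congr `|_|; ring.
  - by move=> z; apply: continuous_comp; [exact: opp_continuous|exact: fc].
  - by rewrite lerN2.
have [z zxy ->] := MVT_segment xy (fun z _ => fdf z) (continuous_subspaceT fc).
rewrite normrM ler_wpM2r//; apply: dfc.
move: zxy; rewrite in_itv/= => /andP[xz zy].
by rewrite !ger0_norm ?subr_ge0// lerB.
Qed.

Lemma cos_lipschitz x y : `|cos y - cos x| <= `|y - x|.
Proof.
rewrite -[leRHS]mul1r; apply: (@mean_value_bound _ (fun z => - sin z)) => // z _.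
by rewrite normrN sin_max.
Qed.

Lemma sin_lipschitz x y : `|sin y - sin x| <= `|y - x|.
Proof.
rewrite -[leRHS]mul1r; apply: (@mean_value_bound _ (fun z => cos z)) => // z _.
exact: cos_max.
Qed.

Lemma norm_sin_le x : `|sin x| <= `|x|.
Proof. by have := sin_lipschitz 0 x; rewrite sin0 !subr0. Qed.

Lemma onem_cosE x : 1 - cos x = 2 * sin (x / 2) ^+ 2.
Proof.
have -> : cos x = cos ((x / 2) *+ 2) by congr cos; rewrite -mulr_natr; field.
by rewrite cos_mulr2n sin2cos2; ring.
Qed.

Lemma onem_cos_ge0 x : 0 <= 1 - cos x.
Proof. by rewrite subr_ge0 cos_le1. Qed.

Lemma onem_cos_le x : 1 - cos x <= x ^+ 2 / 2.
Proof.
rewrite onem_cosE.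
have : sin (x / 2) ^+ 2 <= (x / 2) ^+ 2.
  by rewrite -[leLHS]real_normK ?num_real// -[leRHS]real_normK ?num_real// lerXn2r ?nnegrE//
    norm_sin_le.
by lra.
Qed.

Lemma onem_cos_le_norm x : 1 - cos x <= `|x|.
Proof. by rewrite -cos0 (le_trans (ler_norm _))//
  -normrN opprB (le_trans (cos_lipschitz _ _))// subr0. Qed.

Lemma is_derive_sinB x : is_derive x (1 : R) (fun z => sin z - z) (cos x - 1).
Proof. by apply: is_deriveB. Qed.

(** Each Taylor remainder is bounded both quadratically and cubically: the quadratic
bound is the one that survives on the tail of a block, while the cubic one gains
a small factor where the block is small. *)
Lemma sin_sub_le_sqr x : `|sin x - x| <= x ^+ 2.
Proof.
have := @mean_value_bound (fun z => sin z - z) (fun z => cos z - 1) `|x| 0 x is_derive_sinB.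
rewrite sin0 !subr0 -expr2 real_normK ?num_real//; apply=> z.
rewrite subr0 => zx; rewrite -normrN opprB ger0_norm ?onem_cos_ge0//.
exact: le_trans (onem_cos_le_norm _) zx.
Qed.

Lemma sin_sub_le_cube x : `|sin x - x| <= `|x| ^+ 3.
Proof.
have := @mean_value_bound (fun z => sin z - z) (fun z => cos z - 1) (`|x| ^+ 2) 0 x is_derive_sinB.
rewrite sin0 !subr0 -exprSr; apply=> z.
rewrite subr0 => zx; rewrite -normrN opprB ger0_norm ?onem_cos_ge0//.
apply: le_trans (onem_cos_le _) _.
rewrite -[z ^+ 2]real_normK ?num_real// ler_pdivrMr// (@le_trans _ _ (`|x| ^+ 2))//.
  by rewrite lerXn2r ?nnegrE.
by rewrite ler_peMr ?exprn_ge0// ler1n.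
Qed.

Lemma cos_taylor_ge0 x : 0 <= cos x - 1 + x ^+ 2 / 2.
Proof. by have := onem_cos_le x; lra. Qed.

Lemma cos_taylor_le_sqr x : cos x - 1 + x ^+ 2 / 2 <= x ^+ 2.
Proof. by have := onem_cos_ge0 x; have := sqr_ge0 x; lra. Qed.

Lemma cos_taylor_le_cube x : cos x - 1 + x ^+ 2 / 2 <= `|x| ^+ 3.
Proof.
have dg (z : R) : is_derive z (1 : R) (fun z => cos z - 1 + z ^+ 2 / 2) (- sin z + z).
  have -> : (fun z => cos z - 1 + z ^+ 2 / 2) = (cos \- cst 1) \+ (2^-1 *: (id ^+ 2)) :> (R -> R).
    by apply/funext => t /=; rewrite !fctE /= /GRing.scale /= mulrC.
  apply: is_derive_eq.
  by rewrite /GRing.scale/= /GRing.scale /=; field.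
apply: le_trans (ler_norm _) _.
have := @mean_value_bound _ _ (`|x| ^+ 2) 0 x dg.
rewrite cos0 !subr0 subrr add0r expr0n /= mul0r subr0 -exprSr; apply=> z.
rewrite subr0 => zx; rewrite -normrN opprD opprK.
apply: le_trans (sin_sub_le_sqr _) _.
by rewrite -[leLHS]real_normK ?num_real// lerXn2r ?nnegrE.
Qed.

(** The bound is uniform in [x], so that it can be integrated in [x] to differentiate
a characteristic function. *)
Lemma cosD_taylor x y : `|cos (x + y) - cos x + y * sin x| <= y ^+ 2 * 2.
Proof.
rewrite cosD (_ : _ + _ = - (cos x * (1 - cos y)) - sin x * (sin y - y)); last by ring.
apply: le_trans (ler_normB _ _) _.
rewrite normrN !normrM mulr_natr mulr2n lerD//.
  rewrite -[leRHS]mul1r ler_pM// ?cos_max//.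
  by rewrite ger0_norm ?onem_cos_ge0// (le_trans (onem_cos_le _))//; have := sqr_ge0 y; lra.
by rewrite -[leRHS]mul1r ler_pM// ?sin_max// sin_sub_le_sqr.
Qed.

Lemma expRN_taylor x : 0 <= x -> `|expR (- x) - 1 + x| <= x ^+ 2.
Proof.
move=> x0; rewrite ger0_norm; last by have := expR_ge1Dx (- x); lra.
have xp : 0 < 1 + x by lra.
have : expR (- x) <= (1 + x)^-1.
  by rewrite expRN lef_pV2 ?posrE ?expR_gt0// expR_ge1Dx.
have : (1 + x)^-1 <= 1 - x + x ^+ 2.
  rewrite -div1r ler_pdivrMr//.
  by have := exprn_ge0 3 x0; nra.
by lra.
Qed.

(** The one-step errors only add up, because every later step multiplies them by a
factor between 0 and 1. *)
Lemma product_recursion (u q e : nat -> R) (n : nat) :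
  (forall k, (k < n)%N -> 0 <= q k <= 1) ->
  (forall k, (k < n)%N -> `|u k.+1 - q k * u k| <= e k) ->
  `|u n - u 0%N * \prod_(k < n) q k| <= \sum_(k < n) e k.
Proof.
elim: n => [|n ih] hq hu; first by rewrite !big_ord0 mulr1 subrr normr0.
have /andP[q0 q1] := hq n (ltnSn _).
rewrite !big_ord_recr /= (_ : _ - _ =
  q n * (u n - u 0%N * \prod_(k < n) q k) + (u n.+1 - q n * u n)); last by ring.
apply: le_trans (ler_normD _ _) _; apply: lerD; last exact: hu.
rewrite normrM ger0_norm// (le_trans _ (ih _ _))//.
- by rewrite ler_piMl.
- by move=> k kn; apply: hq; exact: ltnW.
- by move=> k kn; apply: hu; exact: ltnW.
Qed.

End elementary.

Lemma eq_cvg_seq (R : realType) (u v : nat -> R) (a : R) : u =1 v ->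
  u n @[n --> \oo] --> a -> v n @[n --> \oo] --> a.
Proof. by move=> /funext ->. Qed.

Lemma cvg_seqD (R : realType) (u v : nat -> R) (a b : R) :
  u n @[n --> \oo] --> a -> v n @[n --> \oo] --> b ->
  u n + v n @[n --> \oo] --> a + b.
Proof. exact: cvgD. Qed.

Lemma cvg_seqB (R : realType) (u v : nat -> R) (a b : R) :
  u n @[n --> \oo] --> a -> v n @[n --> \oo] --> b ->
  u n - v n @[n --> \oo] --> a - b.
Proof. exact: cvgB. Qed.

Lemma cvg_seqM (R : realType) (u v : nat -> R) (a b : R) :
  u n @[n --> \oo] --> a -> v n @[n --> \oo] --> b ->
  u n * v n @[n --> \oo] --> a * b.
Proof. exact: cvgM. Qed.

(** * Integration of real functions over a probability space *)

Section expectation_toolkit.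
Context d (T : measurableType d) (R : realType) (P : probability T R).
Implicit Types f g h : T -> R.
Local Notation intg f := (P.-integrable [set: T] (EFin \o f)).

Lemma integrable_measurable f : intg f -> measurable_fun setT f.
Proof. by move/measurable_int/measurable_EFinP. Qed.

Lemma integrable_dominated f g : measurable_fun setT f ->
  (forall t, `|f t| <= g t) -> intg g -> intg f.
Proof.
move=> mf fg ig; apply: (le_integrable measurableT _ _ ig).
  exact/measurable_EFinP.
by move=> t _ /=; rewrite lee_fin (le_trans (fg t))// ler_norm.
Qed.

Lemma integrable_constant (c : R) : intg (fun=> c).
Proof. exact: finite_measure_integrable_cst. Qed.

Lemma integrable_bounded f (M : R) : measurable_fun setT f ->
  (forall t, `|f t| <= M) -> intg f.
Proof. by move=> mf fM; apply: integrable_dominated (integrable_constant M). Qed.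

Lemma integrable_add f g : intg f -> intg g -> intg (fun t => f t + g t).
Proof. by move=> fi gi; have := integrableD measurableT fi gi. Qed.

Lemma integrable_scale (c : R) f : intg f -> intg (fun t => c * f t).
Proof. by move=> fi; have := integrableZl measurableT c fi. Qed.

Lemma integrable_sub f g : intg f -> intg g -> intg (fun t => f t - g t).
Proof. by move=> fi gi; have := integrableB measurableT fi gi. Qed.

Lemma integrable_bigsum (I : Type) (s : seq I) (F : I -> T -> R) :
  (forall i, intg (F i)) -> intg (fun t => \sum_(i <- s) F i t).
Proof.
move=> iF; elim: s => [|i s ih].
  by under eq_fun do rewrite big_nil; exact: integrable_constant.
by under eq_fun do rewrite big_cons; exact: integrable_add.
Qed.

Lemma expect_constant (c : R) : \int[P]_t c = c.
Proof. by rewrite Rintegral_cst//= probability_setT /= mulr1. Qed.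

Lemma expectD f g : intg f -> intg g ->
  \int[P]_t (f t + g t) = \int[P]_t f t + \int[P]_t g t.
Proof. exact: RintegralD. Qed.

Lemma expectB f g : intg f -> intg g ->
  \int[P]_t (f t - g t) = \int[P]_t f t - \int[P]_t g t.
Proof. exact: RintegralB. Qed.

Lemma expectZ (c : R) f : intg f -> \int[P]_t (c * f t) = c * \int[P]_t f t.
Proof. exact: RintegralZl. Qed.

Lemma expect_le f g : intg f -> intg g -> (forall t, f t <= g t) ->
  \int[P]_t f t <= \int[P]_t g t.
Proof. by move=> fi gi fg; apply: le_Rintegral. Qed.

Lemma norm_expect_le f g : intg f -> intg g -> (forall t, `|f t| <= g t) ->
  `|\int[P]_t f t| <= \int[P]_t g t.
Proof.
move=> fi gi fg; apply: le_trans (le_normr_Rintegral measurableT fi) _.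
by apply: expect_le => //; exact: integrable_norm.
Qed.

Lemma expect_dist_le f g h : intg f -> intg g -> intg h ->
  (forall t, `|f t - g t| <= h t) ->
  `|\int[P]_t f t - \int[P]_t g t| <= \int[P]_t h t.
Proof.
by move=> fi gi hi fgh; rewrite -expectB//; apply: norm_expect_le => //; exact: integrable_sub.
Qed.

Lemma norm_expect_bounded f (M : R) : measurable_fun setT f ->
  (forall t, `|f t| <= M) -> `|\int[P]_t f t| <= M.
Proof.
move=> mf fM; rewrite -[leRHS]expect_constant; apply: norm_expect_le => //.
  exact: integrable_bounded fM.
exact: integrable_constant.
Qed.

Lemma expect_sum (I : Type) (s : seq I) (F : I -> T -> R) :
  (forall i, intg (F i)) ->
  \int[P]_t (\sum_(i <- s) F i t) = \sum_(i <- s) \int[P]_t F i t.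
Proof.
move=> iF; elim: s => [|i s ih].
  by under eq_Rintegral do rewrite big_nil; rewrite big_nil expect_constant.
rewrite big_cons -ih -expectD//; last exact: integrable_bigsum.
by apply: eq_Rintegral => t _; rewrite big_cons.
Qed.

Lemma expect_dominated_cvg (f_ : nat -> T -> R) f g :
  (forall n, measurable_fun setT (f_ n)) -> measurable_fun setT f -> intg g ->
  (forall t, f_ n t @[n --> \oo] --> f t) ->
  (forall n t, `|f_ n t| <= g t) ->
  \int[P]_t f_ n t @[n --> \oo] --> \int[P]_t f t.
Proof.
move=> mf_ mf gi ff fg.
have ffE t : (EFin \o f_ n) t @[n --> \oo] --> (EFin \o f) t.
  by apply: cvg_EFin; [exact: nearW|exact: ff].
have [fi _ cv] := @dominated_convergence _ _ _ P _ measurableT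
  (fun n => EFin \o f_ n) (EFin \o f) (EFin \o g)
  (fun n => (measurable_EFinP _ _).2 (mf_ n)) ((measurable_EFinP _ _).2 mf)
  (aeW _ (fun t _ => ffE t)) gi
  (aeW _ (fun t n _ => fg n t)).
rewrite /Rintegral; apply: fine_cvg.
rewrite fineK; first exact: cv.
exact: integrable_fin_num.
Qed.

End expectation_toolkit.

(** * Bernstein approximation *)

Section bernstein.
Context {R : realType}.
Implicit Types (u c : R) (g : nat -> R).

(** The expectation of [g] under the binomial law with [n] trials of success
probability [u], by conditioning on the last trial. The recursion makes moments
accessible by induction and shows that the mean is a polynomial in [u]. *)
Fixpoint binomial_mean u (n : nat) g : R :=
  if n is n'.+1 then
    (1 - u) * binomial_mean u n' g + u * binomial_mean u n' (fun k => g k.+1)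
  else g 0%N.

Lemma eq_binomial_mean u n g g' : g =1 g' ->
  binomial_mean u n g = binomial_mean u n g'.
Proof. by move=> /funext ->. Qed.

Lemma binomial_mean_le u n g g' : 0 <= u <= 1 ->
  (forall k, (k <= n)%N -> g k <= g' k) ->
  binomial_mean u n g <= binomial_mean u n g'.
Proof.
move=> /andP[u0 u1]; elim: n g g' => [|n ih] g g' gg' /=; first exact: gg'.
apply: lerD; apply: ler_wpM2l; rewrite ?subr_ge0//; apply: ih => k kn; apply: gg' => //.
exact: leqW.
Qed.

Lemma binomial_mean_affine u n g (a c : R) :
  binomial_mean u n (fun k => a * g k + c) = a * binomial_mean u n g + c.
Proof. by elim: n g => [//|n ih] g /=; rewrite ih (ih (fun k => g k.+1)); ring. Qed.

Lemma norm_binomial_mean_sub u n g c : 0 <= u <= 1 ->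
  `|binomial_mean u n g - c| <= binomial_mean u n (fun k => `|g k - c|).
Proof.
move=> u01.
have -> : binomial_mean u n g - c = binomial_mean u n (fun k => g k - c).
  have := binomial_mean_affine u n g 1 (- c).
  by rewrite mul1r => <-; apply: eq_binomial_mean => k; rewrite mul1r.
rewrite ler_norml; apply/andP; split.
  rewrite -[leLHS]addr0 -mulN1r -binomial_mean_affine; apply: binomial_mean_le => // k _.
  by rewrite mulN1r addr0 lerNl -normrN ler_norm.
by apply: binomial_mean_le => // k _; exact: ler_norm.
Qed.

(** Variance plus squared bias. The induction needs the shift [c], since one more
trial replaces it by [c - u] or [c + 1 - u]. *)
Lemma binomial_mean_sqr u n c :
  binomial_mean u n (fun k => (k%:R + c - n%:R * u) ^+ 2) =
  n%:R * (u * (1 - u)) + c ^+ 2.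
Proof.
elim: n c => [|n ih] c /=; first by ring.
rewrite (eq_binomial_mean _ _ (g' := fun k => (k%:R + (c - u) - n%:R * u) ^+ 2)); last first.
  by move=> k; rewrite -(natr1 n); congr (_ ^+ 2); ring.
rewrite [X in _ + _ * X](eq_binomial_mean _ _ (g' := fun k => (k%:R + (c +
  1 - u) - n%:R * u) ^+ 2)); last first.
  by move=> k; rewrite -(natr1 n) -(natr1 k); congr (_ ^+ 2); ring.
by rewrite !ih -(natr1 n); ring.
Qed.

(** Heine's theorem, by a covering argument on the unit interval. *)
Lemma continuous_uniformly_on_unit (h : R -> R) : continuous h ->
  forall e : R, 0 < e -> exists2 delta : R, 0 < delta &
    forall u v, 0 <= u <= 1 -> `|u - v| < delta -> `|h u - h v| < e.
Proof.
move=> ch e e0.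
have /compact_near_coveringP/(_ R (0 : R)^'+
  (fun delta u => forall v, `|u - v| < delta -> `|h u - h v| < e) _) := @segment_compact R 0 1.
case.
  move=> x _.
  have e20 : 0 < e / 2 by rewrite divr_gt0.
  have /cvgrPdist_lt /(_ _ e20) /nbhs_ballP [r /= r0 rP] := ch x.
  have r20 : 0 < r / 2 by rewrite divr_gt0.
  exists (ball x (r / 2), [set delta | delta < r / 2]) => /=.
    by split; [exact: nbhsx_ballx|exact: nbhs_right_lt].
  move=> [u delta] /= [xu dr] v uv.
  have h1 : `|h x - h u| < e / 2.
    by apply: rP; apply: lt_trans xu _; rewrite ltr_pdivrMr// mulr_natr mulr2n ltrDl.
  have h2 : `|h x - h v| < e / 2.
    apply: rP; rewrite /ball /= (_ : x - v = (x - u) + (u - v)); last by ring.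
    by rewrite (le_lt_trans (ler_normD _ _))// [ltRHS]splitr ltrD// (lt_trans uv).
  rewrite (_ : h u - h v = (h x - h v) - (h x - h u)); last by ring.
  by rewrite (le_lt_trans (ler_normB _ _))// [ltRHS]splitr ltrD.
move=> delta0 /= delta0_gt0 dP.
exists (delta0 / 2); first by rewrite divr_gt0.
move=> u v u01 uv; apply: (dP (delta0 / 2)) => //=.
- by rewrite sub0r normrN gtr0_norm ?divr_gt0// ltr_pdivrMr// mulr_natr mulr2n ltrDl.
- by rewrite divr_gt0.
Qed.

(** Chebyshev's inequality: the binomial law with parameters [n] and [u] is
concentrated around [n * u], uniformly in [u]. *)
Lemma bernstein_approximation (h : R -> R) (M : R) : continuous h ->
  (forall u, `|h u| <= M) -> forall e : R, 0 < e -> exists n : nat,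
  forall u, 0 <= u <= 1 ->
    `|binomial_mean u n (fun k => h (k%:R / n%:R)) - h u| <= e.
Proof.
move=> ch hM e e0.
have M0 : 0 <= M by apply: le_trans (hM 0).
have e20 : 0 < e / 2 by rewrite divr_gt0.
have [delta d0 dP] := continuous_uniformly_on_unit ch e20.
(* for this n the Chebyshev term 2 M / (delta^2 n) is at most e / 2 *)
pose n := (Num.truncn (4 * M / (delta ^+ 2 * e))).+1.
have nP : 4 * M / (delta ^+ 2 * e) < n%:R by exact: truncnS_gt.
have n0 : 0 < n%:R :> R by rewrite ltr0n.
have d20 : 0 < delta ^+ 2 by rewrite exprn_gt0.
exists n => u u01.
apply: le_trans (norm_binomial_mean_sub _ _ _ u01) _.
pose a := 2 * M / (delta ^+ 2 * n%:R ^+ 2).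
have bnd k : `|h (k%:R / n%:R) - h u| <= a * (k%:R + 0 - n%:R * u) ^+ 2 + e / 2.
  rewrite addr0 distrC.
  have -> : a * (k%:R - n%:R * u) ^+ 2 = 2 * M * (u - k%:R / n%:R) ^+ 2 / delta ^+ 2.
    by rewrite /a; field; rewrite !gt_eqF.
  have [uk|uk] := ltP `|u - k%:R / n%:R| delta.
    apply: le_trans (ltW (dP _ _ u01 uk)) _; rewrite lerDr.
    by rewrite divr_ge0 ?(ltW d20)// mulr_ge0 ?sqr_ge0// mulr_ge0.
  apply: le_trans (ler_normB _ _) _.
  apply: (@le_trans _ _ (2 * M)); first by rewrite [leRHS]mulr_natl mulr2n lerD.
  rewrite -[leLHS]addr0 lerD ?(ltW e20)//.
  rewrite -mulrA; apply: ler_peMr; first by rewrite mulr_ge0.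
  rewrite ler_pdivlMr// mul1r.
  by rewrite -[leRHS]real_normK ?num_real// lerXn2r ?nnegrE// ltW.
apply: le_trans (binomial_mean_le u01 (fun k _ => bnd k)) _.
rewrite binomial_mean_affine binomial_mean_sqr expr0n addr0 [leRHS]splitr lerD2r.
have -> : a * (n%:R * (u * (1 - u))) = (2 * M / (delta ^+ 2 * n%:R)) * (u * (1 - u)).
  by rewrite /a; field; rewrite !gt_eqF.
apply: (@le_trans _ _ (2 * M / (delta ^+ 2 * n%:R))).
  apply: ler_piMr; first by rewrite divr_ge0 ?mulr_ge0// ltW.
  by case/andP: u01 => ? ?; nra.
rewrite ler_pdivrMr ?mulr_gt0//.
move: nP; rewrite ltr_pdivrMr ?mulr_gt0// => /ltW nP.
nra.
Qed.

End bernstein.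

(** * From characteristic functions to convergence in distribution *)

Section levy.
Context d (T : measurableType d) (R : realType) (P : probability T R).
Context (mu : probability (measurableTypeR R) R) (Y : nat -> T -> R).
Implicit Types g h : R -> R.
Hypothesis mY : forall n, measurable_fun setT (Y n).
Hypothesis cos_cvg : forall t : R,
  \int[P]_w cos (t * Y n w) @[n --> \oo] --> \int[mu]_x cos (t * x).
Hypothesis sin_cvg : forall t : R,
  \int[P]_w sin (t * Y n w) @[n --> \oo] --> \int[mu]_x sin (t * x).

(** Testing [g] against every phase-shifted cosine, and not only against 1, makes the
property stable under multiplication by a sine ([modulated_cvg_sin]), hence true
of every polynomial in a sine. *)
Definition modulated_cvg (g : R -> R) := [/\ measurable_fun setT g,
  (exists M, forall x, `|g x| <= M) &
  forall t th : R, \int[P]_w (g (Y n w) * cos (t * Y n w + th)) @[n --> \oo] -->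
                   \int[mu]_x (g x * cos (t * x + th))].

Lemma measurable_cos_affine (t th : R) :
  measurable_fun [set: R] (fun x => cos (t * x + th)).
Proof.
apply: (measurableT_comp (continuous_measurable_fun (@continuous_cos R))).
by apply: measurable_funD => //; apply: measurable_funM.
Qed.

Lemma modulated_integrable d' (T' : measurableType d') (Q : probability T' R)
    (Z : T' -> R) (g : R -> R) (M t th : R) :
  measurable_fun setT Z -> measurable_fun setT g -> (forall x, `|g x| <= M) ->
  Q.-integrable setT (EFin \o (fun w => g (Z w) * cos (t * Z w + th))).
Proof.
move=> mZ mg gM; apply: (@integrable_bounded _ _ _ _ _ M).
  apply: measurable_funM; first exact: measurableT_comp.
  exact: (measurableT_comp (measurable_cos_affine t th)).
move=> w; rewrite normrM -[leRHS]mulr1 ler_pM//; exact: cos_max.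
Qed.

Lemma modulated_cvg_constant (c : R) : modulated_cvg (fun=> c).
Proof.
split=> [//||t th]; first by exists `|c|.
have E d' (T' : measurableType d') (Q : probability T' R) (Z : T' -> R) :
    measurable_fun setT Z -> \int[Q]_w (c * cos (t * Z w + th)) =
    c * cos th * \int[Q]_w cos (t * Z w) - c * sin th * \int[Q]_w sin (t * Z w).
  move=> mZ.
  have mtZ : measurable_fun setT (fun w => t * Z w) by exact: measurable_funM.
  have ic : Q.-integrable setT (EFin \o (fun w => cos (t * Z w))).
    apply: (@integrable_bounded _ _ _ _ _ 1) => [|w]; last exact: cos_max.
    exact: measurableT_comp (continuous_measurable_fun (@continuous_cos R)) mtZ.
  have is_ : Q.-integrable setT (EFin \o (fun w => sin (t * Z w))).
    apply: (@integrable_bounded _ _ _ _ _ 1) => [|w]; last exact: sin_max.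
    exact: measurableT_comp (continuous_measurable_fun (@continuous_sin R)) mtZ.
  rewrite -!expectZ// -expectB//; [|exact: integrable_scale..].
  by apply: eq_Rintegral => w _; rewrite cosD; ring.
rewrite (E _ _ mu id)//.
under eq_fun do rewrite E//.
by apply: cvgB; apply: cvgMr; [exact: cos_cvg|exact: sin_cvg].
Qed.

Lemma modulated_cvg_lin g h (a b : R) : modulated_cvg g -> modulated_cvg h ->
  modulated_cvg (fun x => a * g x + b * h x).
Proof.
move=> [mg [M gM] gc] [mh [N hN] hc]; split.
- by apply: measurable_funD; apply: measurable_funM.
- exists (`|a| * M + `|b| * N) => x; rewrite (le_trans (ler_normD _ _))//.
  by rewrite !normrM lerD// ler_wpM2l.
move=> t th.
have E d' (T' : measurableType d') (Q : probability T' R) (Z : T' -> R) :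
    measurable_fun setT Z ->
    \int[Q]_w ((a * g (Z w) + b * h (Z w)) * cos (t * Z w + th)) =
    a * \int[Q]_w (g (Z w) * cos (t * Z w + th)) +
    b * \int[Q]_w (h (Z w) * cos (t * Z w + th)).
  move=> mZ.
  have gi := @modulated_integrable _ _ Q Z g M t th mZ mg gM.
  have hi := @modulated_integrable _ _ Q Z h N t th mZ mh hN.
  rewrite -!expectZ// -expectD//; [|exact: integrable_scale..].
  by apply: eq_Rintegral => w _; ring.
rewrite (E _ _ mu id)//.
under eq_fun do rewrite E//.
by apply: cvgD; apply: cvgMr.
Qed.

(** The product-to-sum formula, with the sine written as a cosine shifted by [pi / 2]. *)
Lemma modulated_cvg_sin g (a : R) : modulated_cvg g ->
  modulated_cvg (fun x => g x * sin (a * x)).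
Proof.
move=> [mg [M gM] gc]; split.
- apply: measurable_funM => //.
  by apply: (measurableT_comp (continuous_measurable_fun (@continuous_sin R)));
    exact: measurable_funM.
- exists M => x; rewrite normrM -[leRHS]mulr1 ler_pM//; exact: sin_max.
move=> t th.
have E d' (T' : measurableType d') (Q : probability T' R) (Z : T' -> R) :
    measurable_fun setT Z ->
    \int[Q]_w (g (Z w) * sin (a * Z w) * cos (t * Z w + th)) =
    2^-1 * \int[Q]_w (g (Z w) * cos ((t + a) * Z w + (th - pi / 2))) -
    2^-1 * \int[Q]_w (g (Z w) * cos ((t - a) * Z w + (th - pi / 2))).
  move=> mZ.
  have gi1 := @modulated_integrable _ _ Q Z g M (t + a) (th - pi / 2) mZ mg gM.
  have gi2 := @modulated_integrable _ _ Q Z g M (t - a) (th - pi / 2) mZ mg gM.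
  rewrite -!expectZ// -expectB//; [|exact: integrable_scale..].
  apply: eq_Rintegral => w _; rewrite !addrA !cosBpihalf.
  rewrite (_ : (t + a) * Z w + th = (t * Z w + th) + a * Z w); last by ring.
  rewrite (_ : (t - a) * Z w + th = (t * Z w + th) + - (a * Z w)); last by ring.
  by rewrite !sinD cosN sinN; field.
rewrite (E _ _ mu id)//.
under eq_fun do rewrite E//.
by apply: cvgB; apply: cvgMr.
Qed.

Lemma modulated_cvg_binomial_mean (a : R) n (g : nat -> R) :
  modulated_cvg (fun x => binomial_mean ((1 + sin (a * x)) / 2) n g).
Proof.
elim: n g => [g|n ih g] /=; first exact: modulated_cvg_constant.
have h1 := modulated_cvg_lin (2^-1) (- 2^-1) (ih g) (modulated_cvg_sin a (ih g)).
have h2 := modulated_cvg_lin (2^-1) (2^-1) (ih (fun k => g k.+1)) (modulated_cvg_sin a (ih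
  (fun k => g k.+1))).
have := modulated_cvg_lin 1 1 h1 h2; congr modulated_cvg.
by apply/funext => x; field.
Qed.

Lemma modulated_cvgW g : modulated_cvg g ->
  \int[P]_w g (Y n w) @[n --> \oo] --> \int[mu]_x g x.
Proof.
move=> [_ _ /(_ 0 0)].
under eq_fun do under eq_Rintegral do rewrite mul0r add0r cos0 mulr1.
by under [X in _ --> X -> _]eq_Rintegral do rewrite mul0r add0r cos0 mulr1.
Qed.

Hypothesis Y2 : forall n, P.-integrable setT (EFin \o (fun w => Y n w ^+ 2)).
Hypothesis mu2 : mu.-integrable setT (EFin \o (fun x => x ^+ 2)).
Variable C : R.
Hypothesis Y2C : forall n, \int[P]_w (Y n w ^+ 2) <= C.
Hypothesis mu2C : \int[mu]_x (x ^+ 2) <= C.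


(** Let [K] be large. Through the arc sine, [f] coincides on [|x| <= K / 2] with a
function [h] of [(1 + sin (x / K)) / 2], where [h] is continuous and bounded like
[f]. A Bernstein polynomial of [h] is close to [f] there; outside, the difference
is at most [2 * M], hence at most [8 * M / K ^+ 2 * x ^+ 2], and the bounded
second moments control it. *)
Lemma levy_continuity : cvg_in_distribution P Y mu.
Proof.
move=> f cf bf.
have [M fM] : exists M, forall x, `|f x| <= M.
  by case: bf => M0 [_ /(_ (M0 + 1))] h; exists (M0 + 1) => x; apply: h => //; rewrite ltrDl.
have mf : measurable_fun setT f by exact: continuous_measurable_fun.
have M0 : 0 <= M by apply: le_trans (fM 0).
have fi d' (T' : measurableType d') (Q : probability T' R) (Z : T' -> R) :
    measurable_fun setT Z -> Q.-integrable setT (EFin \o (f \o Z)).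
  move=> mZ; apply: (@integrable_bounded _ _ _ _ _ M) => [|w]; last exact: fM.
  exact: measurableT_comp.
suff main : \int[P]_w f (Y n w) @[n --> \oo] --> \int[mu]_x f x.
  rewrite -[X in _ --> X]fineK; last exact: integrable_fin_num (fi _ _ mu id _).
  apply: cvg_EFin.
    apply: nearW => n; rewrite unlock; exact: integrable_fin_num (fi _ _ P (Y n) (mY n)).
  by move: main; apply: cvg_trans; apply: near_eq_cvg; apply: nearW => n /=; rewrite unlock.
apply/cvgrPdist_le => e e0.
have C0 : 0 <= C by apply: le_trans mu2C; apply: Rintegral_ge0 => x _; exact: sqr_ge0.
have e4 : 0 < e / 5 by rewrite divr_gt0.
pose K : R := (Num.truncn (8 * M * C / (e / 5))).+1%:R.
have KP : 8 * M * C / (e / 5) < K by exact: truncnS_gt.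
have K1 : 1 <= K by rewrite ler1n.
have K0 : 0 < K by exact: lt_le_trans K1.
have KC : 8 * M / K ^+ 2 * C <= e / 5.
  rewrite mulrAC ler_pdivrMr ?exprn_gt0//.
  move: KP; rewrite ltr_pdivrMr// => /ltW/le_trans; apply.
  by rewrite mulrC ler_wpM2l// ?(ltW e4)// ler_eXnr.
(* the clamp keeps the arc sine in the interior of its domain *)
pose h u := f (K * asin (Num.max (- 2^-1) (Num.min (2 * u - 1) 2^-1))).
have ch : continuous h.
  move=> u; apply: continuous_comp; last exact: cf.
  apply: continuousM; first exact: cst_continuous.
  apply: (continuous_comp (f := fun u : R => Num.max (- 2^-1) (Num.min (2 * u - 1) 2^-1))).
    apply: continuous_max; first exact: cst_continuous.
    apply: continuous_min; last exact: cst_continuous.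
    apply: continuousB; last exact: cst_continuous.
    by apply: continuousM; [exact: cst_continuous|exact: cvg_id].
  apply: continuous_asin.
  have h1 : - 1 < - 2^-1 :> R by lra.
  have h2 : - 2^-1 < 1 :> R by lra.
  have h3 : 2^-1 < 1 :> R by lra.
  by rewrite lt_max gt_max gt_min h1 h2 h3 orbT.
have hM u : `|h u| <= M by exact: fM.
have [n nP] := bernstein_approximation ch hM e4.
pose q x := binomial_mean ((1 + sin (K^-1 * x)) / 2) n (fun k => h (k%:R / n%:R)).
have qc : modulated_cvg q := modulated_cvg_binomial_mean K^-1 n _.
have fq x : `|f x - q x| <= e / 5 + 8 * M / K ^+ 2 * x ^+ 2.
  have u01 : 0 <= (1 + sin (K^-1 * x)) / 2 <= 1.
    by have := sin_le1 (K^-1 * x); have := sin_geN1 (K^-1 * x); lra.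
  rewrite (_ : f x - q x = (h ((1 + sin (K^-1 * x)) / 2) - q x) + (f x - h ((1 +
    sin (K^-1 * x)) / 2))); last by ring.
  apply: le_trans (ler_normD _ _) _; apply: lerD; first by rewrite distrC; exact: nP.
  have [xK|xK] := leP (`|x|) (K / 2).
    rewrite (_ : h _ = f x) ?subrr ?normr0.
      by rewrite mulr_ge0 ?sqr_ge0// divr_ge0 ?sqr_ge0// mulr_ge0.
    rewrite /h; congr f.
    have xK' : `|K^-1 * x| <= 2^-1.
      by rewrite normrM gtr0_norm ?invr_gt0// mulrC ler_pdivrMr// mulrC.
    have := norm_sin_le (K^-1 * x) => /le_trans /(_ xK').
    rewrite ler_norml => /andP[s1 s2].
    rewrite (_ : 2 * _ - 1 = sin (K^-1 * x)); last by field.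
    rewrite (min_idPl _)// (max_idPr _)// sinK ?mulrA ?divff ?gt_eqF ?mul1r//.
    move: xK'; rewrite ler_norml in_itv /= => /andP[k1 k2].
    have p2 : 1 <= pi / 2 :> R := pihalf_ge1 R.
    by apply/andP; split; [apply: le_trans k1|apply: le_trans k2 _]; lra.
  apply: le_trans (ler_normB _ _) _.
  apply: (@le_trans _ _ (2 * M)); first by rewrite [leRHS]mulr_natl mulr2n lerD.
  rewrite mulrAC ler_pdivlMr ?exprn_gt0//.
  have : (K / 2) ^+ 2 <= x ^+ 2.
    by rewrite -[leRHS]real_normK ?num_real// lerXn2r ?nnegrE ?divr_ge0// ltW.
  by rewrite expr_div_n; nra.
have near d' (T' : measurableType d') (Q : probability T' R) (Z : T' -> R) :
    measurable_fun setT Z -> Q.-integrable setT (EFin \o (fun w => Z w ^+ 2)) ->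
    \int[Q]_w (Z w ^+ 2) <= C ->
    `|\int[Q]_w f (Z w) - \int[Q]_w q (Z w)| <= e / 5 + e / 5.
  move=> mZ Z2 ZC.
  have [mq [N qN] _] := qc.
  apply: (@le_trans _ _ (\int[Q]_w (e / 5 + 8 * M / K ^+ 2 * Z w ^+ 2))).
    apply: expect_dist_le => [|||w].
    - exact: fi.
    - by apply: (@integrable_bounded _ _ _ _ _ N) => //; exact: measurableT_comp.
    - by apply: integrable_add; [exact: integrable_constant|exact: integrable_scale].
    - exact: fq.
  rewrite expectD; [|exact: integrable_constant|exact: integrable_scale].
  rewrite expect_constant expectZ// lerD2l (le_trans _ KC)// ler_wpM2l//.
  by rewrite divr_ge0 ?sqr_ge0// mulr_ge0.
have := modulated_cvgW qc => /cvgrPdist_le /(_ _ e4).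
apply: filterS => k qk.
rewrite (_ : _ - _ = (\int[mu]_x f x - \int[mu]_x q x) + (\int[mu]_x q x - \int[P]_w q (Y k w)) -
   (\int[P]_w f (Y k w) - \int[P]_w q (Y k w))); last by ring.
apply: le_trans (ler_normB _ _) _.
(* one fifth for each of the two terms of fq, under both laws, and one for the limit *)
apply: (@le_trans _ _ (e / 5 + e / 5 + e / 5 + (e / 5 + e / 5))); last by lra.
apply: lerD; last exact: near.
apply: le_trans (ler_normD _ _) _.
by apply: lerD => //; exact: (near _ _ mu id).
Qed.

End levy.

(** * The characteristic function of the standard normal law *)

Section gaussian.
Context {R : realType}.
Let lambda := @lebesgue_measure R.
Let nu : probability (measurableTypeR R) R := normal_prob (0 : R) 1.
Let phi := normal_pdf (0 : R) 1.

Let oner0 : (1 : R) != 0. Proof. exact: oner_neq0. Qed.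

Lemma normal_pdf01E x : phi x = normal_peak 1 * expR (- (x ^+ 2 / 2)).
Proof. by rewrite /phi normal_pdfE// /normal_fun subr0 expr1n mulNr. Qed.

(** The normal law is defined by the integral of its density over sets; integrals of
functions against it are reached through the Radon-Nikodym derivative. *)
Lemma normal_density_ae : ae_eq lambda setT
  (Radon_Nikodym_SigmaFinite.f nu lambda) (EFin \o phi).
Proof.
have dom : nu `<< lambda := normal_prob_dominates 0 1.
apply: integral_ae_eq => //.
- exact: Radon_Nikodym_SigmaFinite.f_integrable.
- by apply/measurable_EFinP; exact: measurable_normal_pdf.
- by move=> E _ mE; rewrite -Radon_Nikodym_SigmaFinite.f_integral.
Qed.

Lemma normal_integral_ge0 (f : R -> \bar R) :
  measurable_fun setT f -> (forall x, 0 <= f x)%E ->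
  (\int[nu]_x f x = \int[lambda]_x (f x * (phi x)%:E))%E.
Proof.
have dom : nu `<< lambda := normal_prob_dominates 0 1.
move=> mf f0; rewrite -(Radon_Nikodym_SigmaFinite.change_of_variables dom)//.
apply: ae_eq_integral => //.
- apply: emeasurable_funM => //.
  exact: measurable_int (Radon_Nikodym_SigmaFinite.f_integrable dom).
- apply: emeasurable_funM => //.
  by apply/measurable_EFinP; exact: measurable_normal_pdf.
- by apply: ae_eqe_mul2l; exact: normal_density_ae.
Qed.

Lemma normal_Rintegral (f : R -> R) : nu.-integrable setT (EFin \o f) ->
  \int[nu]_x f x = \int[lambda]_x (f x * phi x).
Proof.
have dom : nu `<< lambda := normal_prob_dominates 0 1.
move=> fi; rewrite /Rintegral -(Radon_Nikodym_change_of_variables dom)//; congr fine.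
have mf := measurable_int _ fi.
apply: ae_eq_integral => //.
- exact: emeasurable_funM.
- suff : measurable_fun setT (EFin \o (fun x => f x * phi x)) by [].
  apply/measurable_EFinP/measurable_funM; first exact/measurable_EFinP.
  exact: measurable_normal_pdf.
- pose fE : measurableTypeR R -> \bar R := EFin \o f.
  have h1 := ae_eqe_mul2l fE (ae_eq_Radon_Nikodym_SigmaFinite dom measurableT).
  have h2 := ae_eqe_mul2l fE normal_density_ae.
  exact: ae_eq_trans (ae_eq_sym h1) h2.
Qed.

(** Half of the exponent of the density absorbs the square, which leaves a multiple of
the density of variance 2. *)
Lemma normal_sqr_integrable : nu.-integrable setT (EFin \o (fun x : R => x ^+ 2)).
Proof.
have msq : measurable_fun setT (EFin \o (fun x : R => x ^+ 2)).
  by apply/measurable_EFinP; exact: measurable_funX.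
apply/integrableP; split => //.
rewrite normal_integral_ge0//; last exact: measurableT_comp.
pose s : R := Num.sqrt 2.
have s0 : s != 0 by rewrite gt_eqF// sqrtr_gt0.
have s2 : s ^+ 2 = 2 by rewrite sqr_sqrtr.
have ss : 0 < normal_peak s by exact: normal_peak_gt0.
pose c := 4 * normal_peak 1 / normal_peak s.
apply: (@le_lt_trans _ _ (\int[lambda]_x (c%:E * (normal_pdf 0 s x)%:E)))%E.
  apply: ge0_le_integral => //.
  - by move=> x _; rewrite mule_ge0// lee_fin normal_pdf_ge0.
  - apply: emeasurable_funM; first exact: measurableT_comp.
    by apply/measurable_EFinP; exact: measurable_normal_pdf.
  - by apply: measurable_funeM; apply/measurable_EFinP; exact: measurable_normal_pdf.
  move=> x _; rewrite /= -EFinM lee_fin ger0_norm ?sqr_ge0//.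
  rewrite normal_pdf01E normal_pdfE// /normal_fun s2 subr0.
  rewrite (_ : c * _ = normal_peak 1 * (4 * expR (- x ^+ 2 / (2 *+ 2)))); last first.
    by rewrite /c; field; rewrite gt_eqF.
  rewrite mulrCA ler_wpM2l ?normal_peak_ge0//.
  have -> : expR (- (x ^+ 2 / 2)) = expR (- x ^+ 2 / (2 *+ 2)) * expR (- x ^+ 2 / (2 *+ 2)).
    by rewrite -expRD; congr expR; field.
  rewrite mulrA ler_wpM2r ?expR_ge0//.
  rewrite mulNr expRN ler_pdivrMr ?expR_gt0//.
  have := expR_ge1Dx (x ^+ 2 / (2 *+ 2)).
  have -> : x ^+ 2 / (2 *+ 2) = x ^+ 2 / 4 by congr (_ / _); rewrite -mulr_natr -natrM.
  lra.
rewrite integralZl//; last exact: integrable_normal_pdf.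
by rewrite integral_normal_pdf mule1 ltry.
Qed.


Lemma normal_norm_integrable : nu.-integrable setT (EFin \o (fun x : R => `|x|)).
Proof.
apply: (@integrable_dominated _ _ _ nu (fun x : R => `|x|) (fun x : R => 1 + x ^+ 2)) => //.
- exact: normr_measurable.
- move=> x; rewrite normr_id; have := sqr_ge0 (`|x| - 1).
  have := sqr_ge0 x; rewrite -[x ^+ 2]real_normK ?num_real//; nra.
- by apply: integrable_add; [exact: integrable_constant|exact: normal_sqr_integrable].
Qed.

Lemma is_derive_sin_normal_pdf (t th x : R) :
  is_derive x (1 : R) (fun x => sin (t * x + th) * phi x)
    ((t * cos (t * x + th) - x * sin (t * x + th)) * phi x).
Proof.
have dl : is_derive x (1 : R) (fun x : R => t * x + th) t.
  have -> : (fun x : R => t * x + th) = (t *: id) \+ cst th :> (R -> R) by apply/funext.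
  by apply: is_derive_eq; rewrite addr0 /GRing.scale /= mulr1.
have ds := @is_derive1_comp R sin (fun x : R => t * x + th) x _ t _ dl.
have dq : is_derive x (1 : R) (fun x : R => - (x ^+ 2 / 2)) (- x).
  have -> : (fun x : R => - (x ^+ 2 / 2)) = ((- 2^-1) *: (id ^+ 2)) :> (R -> R).
    by apply/funext => y /=; rewrite !fctE /GRing.scale /= mulNr mulrC.
  by apply: is_derive_eq; rewrite /GRing.scale /= /GRing.scale /=; field.
have de := @is_derive1_comp R expR (fun x : R => - (x ^+ 2 / 2)) x _ (- x) _ dq.
have -> : (fun x => sin (t * x + th) * phi x) =
  (sin \o (fun x => t * x + th)) \* (normal_peak 1 *: (expR \o (fun x => - (x ^+ 2 / 2)))) :>
    (R -> R).
  by apply/funext => y /=; rewrite normal_pdf01E.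
apply: is_derive_eq.
by rewrite normal_pdf01E /GRing.scale /= /GRing.scale /=; ring.
Qed.


Lemma normal_pdf01_cvg0 : phi n%:R @[n --> \oo] --> (0 : R).
Proof.
have p0 : 0 <= normal_peak 1 :> R by exact: normal_peak_ge0.
apply: (@squeeze_cvgr _ _ _ _ (fun=> 0) (fun n => 2 * normal_peak 1 * n.+1%:R^-1)).
- near=> n.
  have n1 : 1 <= n%:R :> R by rewrite ler1n; near: n; exact: nbhs_infty_ge.
  rewrite normal_pdf01E mulr_ge0 ?expR_ge0//= (mulrC 2) -[leRHS]mulrA ler_wpM2l//.
  rewrite expRN ler_pdivlMr ?ltr0n// mulrC ler_pdivrMr ?expR_gt0//.
  have := expR_ge1Dx (n%:R ^+ 2 / 2 : R); rewrite -(natr1 n); nra.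
- exact: cvg_cst.
- rewrite -[X in _ --> X](mulr0 (2 * normal_peak 1)).
  by apply: cvgMr; exact: cvg_harmonic.
Unshelve. all: end_near. Qed.

(** The integrand of the difference, times the density, is the derivative of
[sin (t * x + th)] times the density, which vanishes at infinity. The fundamental
theorem is applied on [[-n, n]], and dominated convergence lets [n] grow. *)
Lemma normal_sin_by_parts (t th : R) :
  \int[nu]_x (x * sin (t * x + th)) = t * \int[nu]_x cos (t * x + th).
Proof.
have mc : measurable_fun [set: R] (fun x : R => cos (t * x + th)).
  apply: (measurableT_comp (continuous_measurable_fun (@continuous_cos R))).
  by apply: measurable_funD => //; exact: measurable_funM.
have ms : measurable_fun [set: R] (fun x : R => x * sin (t * x + th)).
  apply: measurable_funM => //.
  apply: (measurableT_comp (continuous_measurable_fun (@continuous_sin R))).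
  by apply: measurable_funD => //; exact: measurable_funM.
have ic : nu.-integrable setT (EFin \o (fun x : R => cos (t * x + th))).
  by apply: (@integrable_bounded _ _ _ nu _ 1) => // x; exact: cos_max.
have is_ : nu.-integrable setT (EFin \o (fun x : R => x * sin (t * x + th))).
  apply: (@integrable_dominated _ _ _ nu _ _ _ _ normal_norm_integrable) => //.
  by move=> x; rewrite normrM ler_piMr// sin_max.
pose g (x : R) := t * cos (t * x + th) - x * sin (t * x + th).
have ig : nu.-integrable setT (EFin \o g).
  by apply: integrable_sub => //; exact: integrable_scale.
suff : \int[nu]_x g x = 0.
  rewrite /g expectB//; last exact: integrable_scale.
  by rewrite expectZ// => /eqP; rewrite subr_eq0 => /eqP ->.
pose A n : set R := `[- n%:R, n%:R]%classic.
pose gn n x := g x * \1_(A n) x.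
have mg : measurable_fun setT g by exact: (integrable_measurable ig).
have mgn n : measurable_fun setT (gn n).
  by apply: measurable_funM => //; apply: measurable_indic; exact: measurable_itv.
have cv1 : \int[nu]_x gn n x @[n --> \oo] --> \int[nu]_x g x.
  apply: (@expect_dominated_cvg _ _ _ nu _ _ (fun x => `|g x|)) => //.
  - exact: integrable_norm.
  - move=> x; apply: cvg_near_cst; near=> n.
    rewrite /gn indicE mem_set ?mulr1// /A /= in_itv/= -ler_norml.
    by near: n; exact: nbhs_infty_ger.
  - move=> n x; rewrite /gn normrM ler_piMr// indicE; case: (_ \in _) => //=.
      by rewrite normr1.
    by rewrite normr0.
have cv2 : \int[nu]_x gn n x @[n --> \oo] --> (0 : R).
  have E n : (0 < n)%N -> \int[nu]_x gn n x =
      sin (t * n%:R + th) * phi n%:R - sin (t * - n%:R + th) * phi n%:R.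
    move=> n0.
    have pe : phi (- n%:R) = phi n%:R by rewrite !normal_pdf01E sqrrN.
    have nn : - n%:R < n%:R :> R by rewrite gtrN ?ltr0n.
    have ign : nu.-integrable setT (EFin \o gn n).
      apply: (@integrable_dominated _ _ _ nu _ (fun x => `|g x|)) => [|x|];
        [exact: mgn| |exact: integrable_norm].
      by rewrite /gn normrM ler_piMr// indicE; case: (_ \in _); rewrite /= ?normr1 ?normr0.
    rewrite normal_Rintegral//.
    have -> : \int[lambda]_x (gn n x * phi x) = \int[lambda]_(x in A n) (g x * phi x).
      rewrite [RHS]Rintegral_mkcond; apply: eq_Rintegral => x _.
      rewrite /gn patchE indicE; case: ifPn => _ /=; first by rewrite mulr1.
      by rewrite mulr0 mul0r.
    have FE := is_derive_sin_normal_pdf t th.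
    have Fc : continuous (fun x => sin (t * x + th) * phi x).
      by move=> x; apply: differentiable_continuous; apply/derivable1_diffP; have [] := FE x.
    rewrite /Rintegral (@continuous_FTC2 _ _ (fun x => sin (t * x + th) * phi x))//.
    - by rewrite /= pe.
    - apply: continuous_subspaceT => x; apply: continuousM; last by move=> *;
        exact: (@continuous_normal_pdf R 0 1 oner0 x).
      apply: continuousB; apply: continuousM; try exact: cst_continuous; try exact: cvg_id.
        apply: continuous_comp; last exact: continuous_cos.
        apply: continuousD; last exact: cst_continuous.
        by apply: continuousM => //; exact: cst_continuous.
      apply: continuous_comp; last exact: continuous_sin.
      apply: continuousD; last exact: cst_continuous.
      by apply: continuousM => //; exact: cst_continuous.
    - split.
      + by move=> x _; have [] := FE x.
      + by apply: cvg_at_right_filter; exact: Fc.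
      + by apply: cvg_at_left_filter; exact: Fc.
    - by move=> x _; rewrite derive1E; have [_ ->] := FE x.
  apply/cvgr0Pnorm_le => e e0.
  have e2 : 0 < e / 2 by rewrite divr_gt0.
  have /cvgr0Pnorm_le /(_ _ e2) := normal_pdf01_cvg0.
  apply: filterS2 (nbhs_infty_gt 0) => n n0 pn; rewrite E//.
  rewrite -mulrBl normrM (le_trans (ler_wpM2r (normr_ge0 _) (_ : _ <= 2)))//.
    by rewrite (le_trans (ler_normB _ _))// -[2]/(1 + 1) lerD// sin_max.
  by rewrite mulrC -ler_pdivlMr.
exact: (cvg_unique _ cv1 cv2).
Unshelve. all: end_near. Qed.

(** A quadratic bound on the remainder pins down the derivative. *)
Lemma is_derive_linearization (h : R -> R) (t d C : R) :
  (forall u, `|h (t + u) - h t - u * d| <= C * u ^+ 2) -> is_derive t (1 : R) h d.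
Proof.
move=> hC.
have C0 : 0 <= C by have := hC 1; rewrite expr1n mulr1; apply: le_trans.
have lim : u^-1 *: ((h \o shift t) (u *: (1 : R)) - h t) @[u --> (0 : R)^'] --> d.
  apply/cvgrPdist_le => e e0.
  near=> u.
  have u0 : u != 0 by near: u; exact: nbhs_dnbhs_neq.
  rewrite /GRing.scale /= mulr1 (addrC u t).
  rewrite (_ : _ - _ = - (u^-1 * (h (t + u) - h t - u * d))); last by field.
  rewrite normrN normrM normfV ler_pdivrMl ?normr_gt0//.
  apply: le_trans (hC u) _.
  rewrite -[u ^+ 2]real_normK ?num_real// expr2 mulrA mulrC ler_wpM2l//.
  rewrite -(ler_pM2r (_ : 0 < (C + 1)^-1)) ?invr_gt0 ?ltr_wpDl//.
  apply: (@le_trans _ _ `|u|).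
    rewrite -mulrA mulrC -mulrA ler_piMr// mulrC ler_pdivrMr ?ltr_wpDl//.
    by rewrite mul1r lerDl.
  near: u; apply: dnbhs0_le; by rewrite divr_gt0// ltr_wpDl.
have dh : derivable h t 1 by apply/cvg_ex; exists d.
by apply: DeriveDef => //; apply/cvg_lim.
Unshelve. all: end_near. Qed.

(** As a function of [t], the integral [h] satisfies [h' = - t h] by
[normal_sin_by_parts], so that [h t * expR (t ^+ 2 / 2)] is constant. The phase
[th] handles the cosine and the sine together. *)
Lemma normal_cos_phase (t th : R) :
  \int[nu]_x cos (t * x + th) = cos th * expR (- (t ^+ 2 / 2)).
Proof.
pose h t := \int[nu]_x cos (t * x + th).
have mcs (f : R -> R) s : continuous f -> measurable_fun [set: R] (fun x : R => f (s * x + th)).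
  move=> cf; apply: (measurableT_comp (continuous_measurable_fun cf)).
  by apply: measurable_funD => //; exact: measurable_funM.
have ic s : nu.-integrable setT (EFin \o (fun x : R => cos (s * x + th))).
  apply: (@integrable_bounded _ _ _ nu _ 1) => [|x]; last exact: cos_max.
  exact: mcs (@continuous_cos R).
have is_ s : nu.-integrable setT (EFin \o (fun x : R => x * sin (s * x + th))).
  apply: (@integrable_dominated _ _ _ nu _ _ _ _ normal_norm_integrable) => //.
    by apply: measurable_funM => //; exact: mcs (@continuous_sin R).
  by move=> x; rewrite normrM ler_piMr// sin_max.
have dh s : is_derive s (1 : R) h (- (s * h s)).
  apply: (@is_derive_linearization _ _ _ (2 * \int[nu]_x (x ^+ 2))) => u.
  rewrite /h -normal_sin_by_parts mulrN opprK -expectZ// -expectB// -expectD//; last 2 first.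
  - exact: integrable_sub.
  - exact: integrable_scale.
  rewrite mulrAC -expectZ; last exact: normal_sqr_integrable.
  apply: norm_expect_le => [||x].
  - by apply: integrable_add; [exact: integrable_sub|exact: integrable_scale].
  - by apply: integrable_scale; exact: normal_sqr_integrable.
  - have := cosD_taylor (s * x + th) (u * x).
    rewrite exprMn (_ : s * x + th + u * x = (s + u) * x + th); last by ring.
    by rewrite mulrA (_ : u ^+ 2 * x ^+ 2 * 2 = 2 * u ^+ 2 * x ^+ 2)//; ring.
have dE s : is_derive s (1 : R) (fun s : R => s ^+ 2 / 2) s.
  have -> : (fun x : R => x ^+ 2 / 2) = (2^-1 *: (id ^+ 2)) :> (R -> R).
    by apply/funext => y /=; rewrite !fctE /GRing.scale /= mulrC.
  by apply: is_derive_eq; rewrite /GRing.scale /= /GRing.scale /=; field.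
have de s := @is_derive1_comp R expR (fun x : R => x ^+ 2 / 2) s _ s _ (dE s).
have cst s : is_derive s (1 : R) (h \* (expR \o (fun s => s ^+ 2 / 2))) 0.
  apply: is_derive_eq.
  by rewrite /GRing.scale /=; ring.
have := is_derive_0_is_cst t 0 cst.
rewrite /= expr0n /= mul0r expR0 mulr1 => ht.
have h0 : h 0 = cos th.
  by rewrite /h; under eq_Rintegral do rewrite mul0r add0r; rewrite expect_constant.
by rewrite -/(h t) expRN -h0 -ht mulfK// gt_eqF// expR_gt0.
Qed.

Lemma normal_cos (t : R) : \int[nu]_x cos (t * x) = expR (- (t ^+ 2 / 2)).
Proof.
have := normal_cos_phase t 0; rewrite cos0 mul1r => <-.
by apply: eq_Rintegral => x _; rewrite addr0.
Qed.

Lemma normal_sin (t : R) : \int[nu]_x sin (t * x) = 0.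
Proof.
have := normal_cos_phase t (- (pi / 2)).
rewrite cosN cos_pihalf mul0r => <-.
by apply: eq_Rintegral => x _; rewrite cosBpihalf.
Qed.

End gaussian.

(** * Square-integrable variables and their covariance *)

Section square_integrable.
Context d (T : measurableType d) (R : realType) (P : probability T R).
Implicit Types f g h : T -> R.
Local Notation intg f := (P.-integrable [set: T] (EFin \o f)).

(** Stated through the square itself, since this is what dominates products. *)
Definition square_integrable f :=
  measurable_fun setT f /\ intg (fun t => f t ^+ 2).

Lemma Lfun2_square_integrable f : f \in Lfun P 2%:E -> square_integrable f.
Proof.
move=> f2; split; last exact: Lfun2_integrable_sqr.
by move: f2; rewrite inE => /andP[/[!inE]].
Qed.

Lemma square_integrable_mul f g : square_integrable f -> square_integrable g ->
  intg (fun t => f t * g t).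
Proof.
move=> [mf f2] [mg g2].
apply: (integrable_dominated _ _ (integrable_add f2 g2)).
  exact: measurable_funM.
move=> t; rewrite normrM -(real_normK (num_real (f t))) -(real_normK (num_real (g t))).
have := sqr_ge0 (`|f t| - `|g t|).
have := normr_ge0 (f t); have := normr_ge0 (g t); nra.
Qed.

Lemma square_integrable_bounded f (M : R) : measurable_fun setT f ->
  (forall t, `|f t| <= M) -> square_integrable f.
Proof.
move=> mf fM; split=> //; apply: (@integrable_bounded _ _ _ _ _ (M ^+ 2)).
  exact: measurable_funX.
by move=> t; rewrite normrX lerXn2r ?nnegrE// (le_trans _ (fM t)).
Qed.

Lemma square_integrable_constant (c : R) : square_integrable (fun=> c).
Proof. exact: (@square_integrable_bounded _ `|c|). Qed.

Lemma square_integrableW f : square_integrable f -> intg f.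
Proof.
move=> f2; have := square_integrable_mul f2 (square_integrable_constant 1).
by under eq_fun do rewrite mulr1.
Qed.

Lemma square_integrable_add f g : square_integrable f -> square_integrable g ->
  square_integrable (fun t => f t + g t).
Proof.
move=> fs gs; have [mf f2] := fs; have [mg g2] := gs.
split; first exact: measurable_funD.
have := integrable_add (integrable_add f2 g2) (integrable_scale 2 (square_integrable_mul fs gs)).
by congr (P.-integrable _ (EFin \o _)); apply/funext => t; ring.
Qed.

Lemma square_integrable_scale (c : R) f : square_integrable f ->
  square_integrable (fun t => c * f t).
Proof.
move=> [mf f2]; split; first exact: measurable_funM.
under eq_fun do rewrite exprMn.
exact: integrable_scale.
Qed.

Lemma square_integrable_sum (s : seq nat) (F : nat -> T -> R) :
  (forall i, i \in s -> square_integrable (F i)) ->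
  square_integrable (fun t => \sum_(i <- s) F i t).
Proof.
elim: s => [|i s ih] sF.
  by under eq_fun do rewrite big_nil; exact: square_integrable_constant.
under eq_fun do rewrite big_cons.
apply: square_integrable_add; first by apply: sF; rewrite mem_head.
by apply: ih => j js; apply: sF; rewrite inE js orbT.
Qed.

Definition real_covariance f g : R :=
  \int[P]_t (f t * g t) - (\int[P]_t f t) * (\int[P]_t g t).

Local Notation cov := real_covariance.

Lemma covC f g : cov f g = cov g f.
Proof. by rewrite /real_covariance mulrC; under eq_Rintegral do rewrite mulrC. Qed.

Lemma covariance_cov f g : square_integrable f -> square_integrable g ->
  covariance P f g = (cov f g)%:E.
Proof.
move=> fs gs.
have fi := square_integrableW fs; have gi := square_integrableW gs.
rewrite covariance.unlock expectation.unlock.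
pose a := \int[P]_t f t; pose b := \int[P]_t g t.
change (\int[P]_t ((f t - a) * (g t - b))%:E = (cov f g)%:E)%E.
have i1 := square_integrable_mul fs gs.
have i2 := integrable_add (integrable_scale (- b) fi) (integrable_scale (- a) gi).
have i3 := integrable_add i2 (integrable_constant P (a * b)).
have i4 := integrable_add i1 i3.
rewrite -[LHS]fineK; last first.
  apply: integrable_fin_num => //; apply: eq_integrable i4 => //.
  by move=> t _ /=; congr EFin; ring.
congr EFin.
transitivity (\int[P]_t (f t * g t + (- b * f t + - a * g t + a * b))).
  by apply: eq_Rintegral => t _; ring.
rewrite expectD// expectD//; last exact: integrable_constant.
rewrite expectD; [|exact: integrable_scale..].
by rewrite expect_constant !expectZ// /real_covariance -/a -/b; ring.
Qed.

Lemma Var_cov f : square_integrable f -> Var P f = cov f f.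
Proof. by move=> fs; rewrite /Var /variance covariance_cov. Qed.

Lemma covDl f g h : square_integrable f -> square_integrable g ->
  square_integrable h -> cov (fun t => f t + g t) h = cov f h + cov g h.
Proof.
move=> fs gs hs; rewrite /real_covariance.
under eq_Rintegral do rewrite mulrDl.
rewrite !expectD; try exact: square_integrable_mul; try exact: square_integrableW.
by ring.
Qed.

Lemma covDr f g h : square_integrable f -> square_integrable g ->
  square_integrable h -> cov h (fun t => f t + g t) = cov h f + cov h g.
Proof. by move=> fs gs hs; rewrite covC covDl// !(covC h). Qed.

Lemma covZl (c : R) f g : square_integrable f -> square_integrable g ->
  cov (fun t => c * f t) g = c * cov f g.
Proof.
move=> fs gs; rewrite /real_covariance.
under eq_Rintegral do rewrite -mulrA.
rewrite !expectZ; try exact: square_integrable_mul; try exact: square_integrableW.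
by ring.
Qed.

Lemma covZr (c : R) f g : square_integrable f -> square_integrable g ->
  cov f (fun t => c * g t) = c * cov f g.
Proof. by move=> fs gs; rewrite covC covZl// covC. Qed.

Lemma VarD f g : square_integrable f -> square_integrable g ->
  Var P (fun t => f t + g t) = Var P f + Var P g + 2 * cov f g.
Proof.
move=> fs gs; have fgs := square_integrable_add fs gs.
by rewrite !Var_cov// covDl// !covDr// (covC g f); ring.
Qed.

Lemma Var_ge0 f : 0 <= Var P f.
Proof. by apply: fine_ge0; exact: variance_ge0. Qed.

Lemma Var_centered f : square_integrable f -> \int[P]_t f t = 0 ->
  Var P f = \int[P]_t (f t ^+ 2).
Proof. by move=> fs f0; rewrite Var_cov// /real_covariance f0 mulr0 subr0. Qed.

End square_integrable.

(** * Covariance inequalities for associated variables *)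

Section association.
Context d (T : measurableType d) (R : realType) (P : probability T R).
Context (X : nat -> {RV P >-> R}).
Local Notation square_integrable := (square_integrable P).
Local Notation cov := (real_covariance P).

(** The length [N] is explicit because association compares two functionals of the
same finite list of variables. *)
Definition monotone_functional (N : nat) (A : T -> R) :=
  exists F : N.-tuple R -> R, [/\ measurable_fun setT F,
    coordinatewise_nondecreasing F & A = F \o (fun t => [tuple X i.+1 t | i < N])].

Lemma monotone_functional_coord N i : (i < N)%N -> monotone_functional N (X i.+1).
Proof.
move=> iN; exists (fun x => tnth x (Ordinal iN)); split.
- exact: measurable_tnth.
- by move=> x y; apply.
- by apply/funext => t /=; rewrite tnth_mktuple.
Qed.

Lemma monotone_functional_comp N A (phi : R -> R) : measurable_fun setT phi ->
  {homo phi : x y / x <= y} -> monotone_functional N A ->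
  monotone_functional N (phi \o A).
Proof.
move=> mphi hphi [F [mF nF ->]]; exists (phi \o F); split => //.
- exact: measurableT_comp.
- by move=> x y xy; apply: hphi; exact: nF.
Qed.

Lemma monotone_functional_add N A B : monotone_functional N A ->
  monotone_functional N B -> monotone_functional N (fun t => A t + B t).
Proof.
move=> [F [mF nF ->]] [G [mG nG ->]]; exists (fun x => F x + G x); split => //.
- exact: measurable_funD.
- by move=> x y xy; apply: lerD; [exact: nF|exact: nG].
Qed.

Lemma monotone_functional_constant N (c : R) : monotone_functional N (fun=> c).
Proof. by exists (fun=> c); split. Qed.

Lemma monotone_functional_window N a b : (b <= N)%N ->
  monotone_functional N (window_sum X a b).
Proof.
move=> bN; rewrite /window_sum.
suff h (s : seq nat) : all (fun i => 0 < i <= N)%N s ->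
    monotone_functional N (fun t => \sum_(i <- s) X i t).
  apply: h; apply/allP => i; rewrite mem_index_iota => /andP[ai ib].
  by rewrite (leq_ltn_trans _ ai)//= (leq_trans _ bN).
elim: s => [_|i s ih /= /andP[/andP[i0 iN] sN]].
  under eq_fun do rewrite big_nil; exact: monotone_functional_constant.
under eq_fun do rewrite big_cons.
apply: monotone_functional_add; last exact: ih.
by rewrite -(prednK i0); apply: monotone_functional_coord; rewrite prednK.
Qed.

Hypothesis X_associated : associated X.

(** Association is a property of bounded functionals. Truncation at height [k] keeps a
functional non-decreasing, and dominated convergence lets [k] grow. *)
Lemma associated_cov_ge0 N A B : monotone_functional N A ->
  monotone_functional N B -> square_integrable A -> square_integrable B ->
  0 <= cov A B.
Proof.
move=> mA mB As Bs.
have [mA' A2] := As; have [mB' B2] := Bs.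
pose phi (k : nat) (x : R) := Num.max (- k%:R) (Num.min x k%:R).
have phi_nd k : {homo phi k : x y / x <= y}.
  move=> x y xy; rewrite /phi ge_max !le_max lexx /=.
  by rewrite le_min !ge_min lexx xy !orbT.
have phi_bnd k x : `|phi k x| <= k%:R.
  rewrite /phi ler_norml le_max lexx /= ge_max ge_min lexx orbT andbT.
  by rewrite (@le_trans _ _ 0)// oppr_le0.
have mphi k : measurable_fun setT (phi k).
  by apply: measurable_maxr => //; apply: measurable_minr.
have phi_le k x : `|phi k x| <= `|x|.
  rewrite /phi; have k0 : 0 <= k%:R :> R by [].
  have [xk|xk] := leP x k%:R; have [kx|kx] := leP (- k%:R) _ => //.
  - by rewrite normrN ger0_norm// ler0_norm; lra.
  - by rewrite !ger0_norm//; lra.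
  - by lra.
have phi_cvg x : phi k x @[k --> \oo] --> x.
  apply: cvg_near_cst; near=> k.
  have : `|x| <= k%:R by near: k; exact: nbhs_infty_ger.
  by rewrite ler_norml /phi => /andP[kx xk]; rewrite (min_idPl xk) (max_idPr kx).
have sq k C : measurable_fun setT C -> square_integrable (phi k \o C).
  move=> mC; apply: (@square_integrable_bounded _ _ _ _ _ k%:R).
    exact: measurableT_comp.
  by move=> t; exact: phi_bnd.
have pos k : 0 <= cov (phi k \o A) (phi k \o B).
  rewrite -lee_fin -covariance_cov; [|exact: sq..].
  have [F [mF nF ->]] := mA; have [G [mG nG ->]] := mB.
  apply: (X_associated (f := phi k \o F) (g := phi k \o G)).
  - exact: measurableT_comp.
  - exact: measurableT_comp.
  - exists k%:R; split; first exact: num_real.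
    by move=> M kM x _; exact: le_trans (phi_bnd _ _) (ltW kM).
  - exists k%:R; split; first exact: num_real.
    by move=> M kM x _; exact: le_trans (phi_bnd _ _) (ltW kM).
  - by move=> x y xy; apply: phi_nd; exact: nF.
  - by move=> x y xy; apply: phi_nd; exact: nG.
have lim : cov (phi k \o A) (phi k \o B) @[k --> \oo] --> cov A B.
  apply: cvgB; last apply: cvgM.
  - apply: (@expect_dominated_cvg _ _ _ P _ _ (fun t => `|A t * B t|)).
    + by move=> k; apply: measurable_funM; exact: measurableT_comp.
    + exact: measurable_funM.
    + by apply: integrable_norm; exact: square_integrable_mul.
    + by move=> t; apply: cvgM; exact: phi_cvg.
    + by move=> k t; rewrite !normrM ler_pM//; exact: phi_le.
  - apply: (@expect_dominated_cvg _ _ _ P _ _ (fun t => `|A t|)) => //.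
    + by move=> k; exact: (measurableT_comp (mphi k)).
    + by apply: integrable_norm; exact: square_integrableW.
    + by move=> t; exact: phi_cvg.
    + by move=> k t; exact: phi_le.
  - apply: (@expect_dominated_cvg _ _ _ P _ _ (fun t => `|B t|)) => //.
    + by move=> k; exact: (measurableT_comp (mphi k)).
    + by apply: integrable_norm; exact: square_integrableW.
    + by move=> t; exact: phi_cvg.
    + by move=> k t; exact: phi_le.
rewrite -(cvg_lim _ lim)//; apply: limr_ge; first by apply/cvg_ex; eexists; exact: lim.
by apply: nearW => k; exact: pos.
Unshelve. all: end_near. Qed.

(** Newman's device: [c x + e * f x] is non-decreasing in [x] for [e = 1] and for
[e = -1]. Among the four nonnegative covariances of [c A + e f A] and
[c B + e' g B], adding the two with [e = e'], or the two with [e = - e'], cancels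
the cross terms. *)
Lemma cov_lipschitz_le N A B (f g : R -> R) (c : R) :
  monotone_functional N A -> monotone_functional N B ->
  square_integrable A -> square_integrable B ->
  measurable_fun setT f -> measurable_fun setT g ->
  (forall x y, `|f x - f y| <= c * `|x - y|) ->
  (forall x y, `|g x - g y| <= c * `|x - y|) ->
  square_integrable (f \o A) -> square_integrable (g \o B) ->
  `|cov (f \o A) (g \o B)| <= c ^+ 2 * cov A B.
Proof.
move=> mA mB As Bs mf mg fc gc fs gs.
have sgn (h : R -> R) C (e : R) : `|e| = 1 -> measurable_fun setT h ->
    (forall x y, `|h x - h y| <= c * `|x - y|) -> monotone_functional N C ->
    monotone_functional N (fun t => c * C t + e * h (C t)).
  move=> e1 mh hc; apply: (monotone_functional_comp (phi := fun x => c * x + e * h x)).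
    by apply: measurable_funD; apply: measurable_funM.
  move=> x y xy; rewrite -subr_ge0.
  have -> : c * y + e * h y - (c * x + e * h x) = c * (y - x) + e * (h y - h x) by ring.
  have := hc y x; rewrite (ger0_norm (_ : 0 <= y - x)) ?subr_ge0//.
  rewrite -[X in X <= _]mul1r -e1 -normrM ler_norml => /andP[h1 _].
  by rewrite addrC -[X in _ + X]opprK subr_ge0.
have pos e e' : `|e| = 1 -> `|e'| = 1 ->
    0 <= c ^+ 2 * cov A B + c * e' * cov A (g \o B) +
         c * e * cov (f \o A) B + e * e' * cov (f \o A) (g \o B).
  move=> e1 e1'.
  have cA := square_integrable_scale c As; have cB := square_integrable_scale c Bs.
  have ef := square_integrable_scale e fs; have eg := square_integrable_scale e' gs.
  have := associated_cov_ge0 (sgn f A e e1 mf fc mA) (sgn g B e' e1' mg gc mB)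
    (square_integrable_add cA ef) (square_integrable_add cB eg).
  rewrite (covDl cA ef (square_integrable_add cB eg)) !covDr//.
  rewrite !covZl// !covZr// => /le_trans; apply; rewrite le_eqVlt; apply/orP; left; apply/eqP.
  by rewrite /=; ring.
have n1 : `|1 : R| = 1 by rewrite normr1.
have nN1 : `|-1 : R| = 1 by rewrite normrN normr1.
have p1 := pos 1 1 n1 n1; have p2 := pos (-1) (-1) nN1 nN1.
have p3 := pos 1 (-1) n1 nN1; have p4 := pos (-1) 1 nN1 n1.
rewrite ler_norml; apply/andP; split; lra.
Qed.

End association.

(** * Characteristic functions of sums of associated variables *)

Section quasi_independence.
Context d (T : measurableType d) (R : realType) (P : probability T R).
Context (X : nat -> {RV P >-> R}).
Hypothesis X_associated : associated X.
Local Notation square_integrable := (square_integrable P).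
Local Notation cov := (real_covariance P).
Local Notation intg f := (P.-integrable [set: T] (EFin \o f)).

Lemma measurable_trig (f : R -> R) (A : T -> R) (tau : R) : continuous f ->
  measurable_fun setT A -> measurable_fun setT (fun t => f (tau * A t)).
Proof.
move=> cf mA; apply: (measurableT_comp (continuous_measurable_fun cf)).
exact: measurable_funM.
Qed.

Lemma square_integrable_cos A (tau : R) : measurable_fun setT A ->
  square_integrable (fun t => cos (tau * A t)).
Proof.
move=> mA; apply: (@square_integrable_bounded _ _ _ _ _ 1) => [|t].
  exact: measurable_trig (@continuous_cos R) mA.
exact: cos_max.
Qed.

Lemma square_integrable_sin A (tau : R) : measurable_fun setT A ->
  square_integrable (fun t => sin (tau * A t)).
Proof.
move=> mA; apply: (@square_integrable_bounded _ _ _ _ _ 1) => [|t].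
  exact: measurable_trig (@continuous_sin R) mA.
exact: sin_max.
Qed.

Lemma norm_expect_cos A (tau : R) : measurable_fun setT A ->
  `|\int[P]_t cos (tau * A t)| <= 1.
Proof.
move=> mA; apply: norm_expect_bounded => [|t]; last exact: cos_max.
exact: measurable_trig (@continuous_cos R) mA.
Qed.

Lemma norm_expect_sin A (tau : R) : measurable_fun setT A ->
  `|\int[P]_t sin (tau * A t)| <= 1.
Proof.
move=> mA; apply: norm_expect_bounded => [|t]; last exact: sin_max.
exact: measurable_trig (@continuous_sin R) mA.
Qed.

Section pair.
Variables (N : nat) (A B : T -> R) (tau : R).
Hypotheses (mA : monotone_functional X N A) (mB : monotone_functional X N B).
Hypotheses (As : square_integrable A) (Bs : square_integrable B).

Let mcos : measurable_fun setT (fun x : R => cos (tau * x)).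
Proof.
apply: (measurableT_comp (continuous_measurable_fun (@continuous_cos R))).
exact: measurable_funM.
Qed.

Let msin : measurable_fun setT (fun x : R => sin (tau * x)).
Proof.
apply: (measurableT_comp (continuous_measurable_fun (@continuous_sin R))).
exact: measurable_funM.
Qed.

Let cos_lip x y : `|cos (tau * x) - cos (tau * y)| <= `|tau| * `|x - y|.
Proof. by rewrite -normrM mulrBr; exact: cos_lipschitz. Qed.

Let sin_lip x y : `|sin (tau * x) - sin (tau * y)| <= `|tau| * `|x - y|.
Proof. by rewrite -normrM mulrBr; exact: sin_lipschitz. Qed.

Let cA := square_integrable_cos tau As.1.
Let sA := square_integrable_sin tau As.1.
Let cB := square_integrable_cos tau Bs.1.
Let sB := square_integrable_sin tau Bs.1.

(** For independent [A] and [B] the left-hand side would vanish, by the addition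
formula; in general it is a combination of two covariances of Lipschitz functions
of [A] and [B]. The same holds for the imaginary part in [expect_sin_add]. *)
Lemma expect_cos_add :
  `|\int[P]_t cos (tau * (A t + B t)) -
    ((\int[P]_t cos (tau * A t)) * (\int[P]_t cos (tau * B t)) -
     (\int[P]_t sin (tau * A t)) * (\int[P]_t sin (tau * B t)))|
  <= 2 * tau ^+ 2 * cov A B.
Proof.
under eq_Rintegral do rewrite mulrDr cosD.
rewrite expectB; [|exact: square_integrable_mul..].
have h1 := cov_lipschitz_le X_associated mA mB As Bs mcos mcos cos_lip cos_lip cA cB.
have h2 := cov_lipschitz_le X_associated mA mB As Bs msin msin sin_lip sin_lip sA sB.
rewrite (_ : _ - _ = cov (fun t => cos (tau * A t)) (fun t => cos (tau * B t)) -
   cov (fun t => sin (tau * A t)) (fun t => sin (tau * B t))); last first.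
  by rewrite /real_covariance; ring.
apply: le_trans (ler_normB _ _) _; apply: le_trans (lerD h1 h2) _.
by rewrite real_normK ?num_real// -mulrA mulr_natl mulr2n.
Qed.

Lemma expect_sin_add :
  `|\int[P]_t sin (tau * (A t + B t)) -
    ((\int[P]_t sin (tau * A t)) * (\int[P]_t cos (tau * B t)) +
     (\int[P]_t cos (tau * A t)) * (\int[P]_t sin (tau * B t)))|
  <= 2 * tau ^+ 2 * cov A B.
Proof.
under eq_Rintegral do rewrite mulrDr sinD.
rewrite expectD; [|exact: square_integrable_mul..].
have h1 := cov_lipschitz_le X_associated mA mB As Bs msin mcos sin_lip cos_lip sA cB.
have h2 := cov_lipschitz_le X_associated mA mB As Bs mcos msin cos_lip sin_lip cA sB.
rewrite (_ : _ - _ = cov (fun t => sin (tau * A t)) (fun t => cos (tau * B t)) +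
   cov (fun t => cos (tau * A t)) (fun t => sin (tau * B t))); last first.
  by rewrite /real_covariance; ring.
apply: le_trans (ler_normD _ _) _; apply: le_trans (lerD h1 h2) _.
by rewrite real_normK ?num_real// -mulrA mulr_natl mulr2n.
Qed.

End pair.

Section partial_sums.
Variables (N m : nat) (W D : nat -> T -> R) (tau : R).
Hypothesis W0 : forall t, W 0%N t = 0.
Hypothesis WS : forall k t, W k.+1 t = W k t + D k t.
Hypothesis mW : forall k, (k < m)%N -> monotone_functional X N (W k).
Hypothesis mD : forall k, (k < m)%N -> monotone_functional X N (D k).
Hypothesis Ws : forall k, square_integrable (W k).
Hypothesis Ds : forall k, square_integrable (D k).

Let c k := cov (W k) (D k).
Let C k := \int[P]_t cos (tau * D k t).
Let S k := \int[P]_t sin (tau * D k t).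
Let x k := \int[P]_t cos (tau * W k t).
Let y k := \int[P]_t sin (tau * W k t).

Let x0 : x 0%N = 1.
Proof. by rewrite /x; under eq_Rintegral do rewrite W0 mulr0 cos0; rewrite expect_constant. Qed.

Let y0 : y 0%N = 0.
Proof. by rewrite /y; under eq_Rintegral do rewrite W0 mulr0 sin0; rewrite expect_constant. Qed.

Let xS k : (k < m)%N -> `|x k.+1 - (x k * C k - y k * S k)| <= 2 * tau ^+ 2 * c k.
Proof.
move=> km; rewrite /x; under eq_Rintegral do rewrite WS.
exact: expect_cos_add (mW km) (mD km) (Ws k) (Ds k).
Qed.

Let yS k : (k < m)%N -> `|y k.+1 - (y k * C k + x k * S k)| <= 2 * tau ^+ 2 * c k.
Proof.
move=> km; rewrite /y; under eq_Rintegral do rewrite WS.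
exact: expect_sin_add (mW km) (mD km) (Ws k) (Ds k).
Qed.

Let x1 k : `|x k| <= 1. Proof. exact: norm_expect_cos (Ws k).1. Qed.
Let y1 k : `|y k| <= 1. Proof. exact: norm_expect_sin (Ws k).1. Qed.

Lemma expRN_sum (v : nat -> R) n : \prod_(k < n) expR (- v k) = expR (- \sum_(k < n) v k).
Proof.
elim: n => [|n ih]; first by rewrite !big_ord0 oppr0 expR0.
by rewrite !big_ord_recr /= ih -expRD; congr expR; ring.
Qed.

(** Meant for [v k] equal to half the variance of [tau * D k]: then [expR (- v k)] is
the characteristic function of a centered normal variable with the same variance,
and the bracket measures how far the [k]-th summand is from normal. *)
Lemma expect_cos_sum (v : nat -> R) : (forall k, 0 <= v k) ->
  `|x m - expR (- \sum_(k < m) v k)| <=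
  \sum_(k < m) (2 * tau ^+ 2 * c k + (`|C k - expR (- v k)| + `|S k|)).
Proof.
move=> v0.
have := @product_recursion _ x (fun k => expR (- v k))
  (fun k => 2 * tau ^+ 2 * c k + (`|C k - expR (- v k)| + `|S k|)) m.
rewrite x0 mul1r expRN_sum; apply.
  by move=> k _; rewrite expR_ge0 /= -[leRHS]expR0 ler_expR oppr_le0.
move=> k km.
rewrite (_ : _ - _ = (x k.+1 - (x k * C k - y k * S k)) +
  (x k * (C k - expR (- v k)) - y k * S k)); last by ring.
apply: le_trans (ler_normD _ _) _; apply: lerD; first exact: xS.
apply: le_trans (ler_normB _ _) _.
by rewrite !normrM; apply: lerD; apply: ler_piMl.
Qed.

Lemma expect_sin_sum (v : nat -> R) : (forall k, 0 <= v k) ->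
  `|y m| <=
  \sum_(k < m) (2 * tau ^+ 2 * c k + (`|C k - expR (- v k)| + `|S k|)).
Proof.
move=> v0.
have := @product_recursion _ y (fun k => expR (- v k))
  (fun k => 2 * tau ^+ 2 * c k + (`|C k - expR (- v k)| + `|S k|)) m.
rewrite y0 mul0r subr0; apply.
  by move=> k _; rewrite expR_ge0 /= -[leRHS]expR0 ler_expR oppr_le0.
move=> k km.
rewrite (_ : _ - _ = (y k.+1 - (y k * C k + x k * S k)) +
  (y k * (C k - expR (- v k)) + x k * S k)); last by ring.
apply: le_trans (ler_normD _ _) _; apply: lerD; first exact: yS.
apply: le_trans (ler_normD _ _) _.
by rewrite !normrM; apply: lerD; apply: ler_piMl.
Qed.

(** The imaginary parts [S k] are only [O(v k)], and their sum need not be small. In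
the squared modulus they enter through [S k ^+ 2], of the order of [v k ^+ 2],
which is why the comparison is made there. *)
Lemma expect_modulus_sum (v : nat -> R) :
  (forall k, 1 - C k <= v k) -> (forall k, `|S k| <= 2 * v k) ->
  `|x m ^+ 2 + y m ^+ 2 - expR (- (2 * \sum_(k < m) (1 - C k)))| <=
  \sum_(k < m) (12 * tau ^+ 2 * c k + 18 * v k ^+ 2).
Proof.
move=> Cv Sv.
have C0 k : 0 <= 1 - C k.
  rewrite subr_ge0; apply: le_trans (ler_norm _) _; exact: norm_expect_cos (Ds k).1.
have := @product_recursion _ (fun k => x k ^+ 2 + y k ^+ 2)
  (fun k => expR (- (2 * (1 - C k))))
  (fun k => 12 * tau ^+ 2 * c k + 18 * v k ^+ 2) m.
rewrite x0 y0 expr1n expr0n /= addr0 mul1r (expRN_sum (fun k => 2 * (1 - C k))) -mulr_sumr; apply.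
  by move=> k _; rewrite expR_ge0 /= -[leRHS]expR0 ler_expR oppr_le0 mulr_ge0.
move=> k km.
have h1 := xS km; have h2 := yS km.
set p := x k * C k - y k * S k in h1; set q := y k * C k + x k * S k in h2.
have Cn : `|C k| <= 1 := norm_expect_cos tau (Ds k).1.
have Sn : `|S k| <= 1 := norm_expect_sin tau (Ds k).1.
have p2 : `|p| <= 2.
  rewrite (le_trans (ler_normB _ _))// !normrM -[2]/(1 + 1) lerD//.
    by rewrite -[leRHS]mulr1 ler_pM.
  by rewrite -[leRHS]mulr1 ler_pM.
have q2 : `|q| <= 2.
  rewrite (le_trans (ler_normD _ _))// !normrM -[2]/(1 + 1) lerD//.
    by rewrite -[leRHS]mulr1 ler_pM.
  by rewrite -[leRHS]mulr1 ler_pM.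
have e1 : `|x k.+1 ^+ 2 - p ^+ 2| <= 3 * (2 * tau ^+ 2 * c k).
  rewrite subr_sqr normrM mulrC ler_pM//.
  by rewrite (le_trans (ler_normD _ _))// (le_trans (lerD (x1 k.+1) p2))//; lra.
have e2 : `|y k.+1 ^+ 2 - q ^+ 2| <= 3 * (2 * tau ^+ 2 * c k).
  rewrite subr_sqr normrM mulrC ler_pM//.
  by rewrite (le_trans (ler_normD _ _))// (le_trans (lerD (y1 k.+1) q2))//; lra.
pose a := 1 - C k.
have e3 : `|p ^+ 2 + q ^+ 2 - expR (- (2 * a)) * (x k ^+ 2 + y k ^+ 2)| <= 18 * v k ^+ 2.
  rewrite (_ : _ - _ = (x k ^+ 2 + y k ^+ 2) *
     ((a ^+ 2 + S k ^+ 2) - (expR (- (2 * a)) - 1 + 2 * a))); last first.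
    by rewrite /p /q /a; ring.
  have h3 : `|x k ^+ 2 + y k ^+ 2| <= 2.
    rewrite (le_trans (ler_normD _ _))// -[2]/(1 + 1) lerD//; rewrite normrX exprn_ile1//.
  have h4 : `|a ^+ 2 + S k ^+ 2 - (expR (- (2 * a)) - 1 + 2 * a)| <= 9 * v k ^+ 2.
    have a0 : 0 <= a by exact: C0.
    have a2 : a ^+ 2 <= v k ^+ 2 by rewrite lerXn2r ?nnegrE// ?(le_trans a0)//; exact: Cv.
    have s2 : S k ^+ 2 <= 4 * v k ^+ 2.
      rewrite -[S k ^+ 2]real_normK ?num_real// (_ : 4 * _ = (2 * v k) ^+ 2); last by ring.
      by rewrite lerXn2r ?nnegrE ?mulr_ge0 ?(le_trans (normr_ge0 _) (Sv k))// (le_trans a0) ?Cv.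
    have := expRN_taylor (mulr_ge0 (ler0n R 2) a0).
    move=> h5; apply: le_trans (ler_normB _ _) _.
    rewrite ger0_norm ?addr_ge0 ?sqr_ge0//; rewrite exprMn in h5.
    by rewrite (le_trans (lerD (lerD a2 s2) (le_trans h5 (ler_wpM2l _ a2))))//; lra.
  rewrite normrM (le_trans (ler_pM _ _ h3 h4))//; lra.
rewrite (_ : _ - _ = (x k.+1 ^+ 2 - p ^+ 2) + (y k.+1 ^+ 2 - q ^+ 2) +
   (p ^+ 2 + q ^+ 2 - expR (- (2 * a)) * (x k ^+ 2 + y k ^+ 2))); last first.
  by rewrite /a; ring.
apply: le_trans (ler_normD _ _) _; apply: lerD => //.
apply: le_trans (ler_normD _ _) _.
by apply: le_trans (lerD e1 e2) _; lra.
Qed.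

End partial_sums.

End quasi_independence.

(** * Second-order expansion for one variable *)

Section single_block.
Context d (T : measurableType d) (R : realType) (P : probability T R).
Variables (A : T -> R) (tau : R).
Local Notation intg f := (P.-integrable [set: T] (EFin \o f)).
Hypothesis As : square_integrable P A.
Hypothesis A0 : \int[P]_t A t = 0.

Definition tail_moment (kappa : R) : R :=
  \int[P]_(t in [set t | kappa <= `|A t|]) (`|A t| ^+ 2).

Let v := tau ^+ 2 * Var P A / 2.

Let icos : intg (fun t => cos (tau * A t)).
Proof. exact: square_integrableW (square_integrable_cos P tau As.1). Qed.

Let isin : intg (fun t => sin (tau * A t)).
Proof. exact: square_integrableW (square_integrable_sin P tau As.1). Qed.

Let iA : intg A. Proof. exact: square_integrableW. Qed.
Let iA2 : intg (fun t => A t ^+ 2). Proof. by case: As. Qed.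

Let scaled_sqr (a : R) : \int[P]_t (a * A t ^+ 2) = a * Var P A.
Proof. by rewrite expectZ// Var_centered. Qed.

Let taylorE : \int[P]_t (cos (tau * A t) - 1 + (tau * A t) ^+ 2 / 2) =
  \int[P]_t cos (tau * A t) - 1 + v.
Proof.
transitivity (\int[P]_t (cos (tau * A t) - 1 + tau ^+ 2 / 2 * A t ^+ 2)).
  by apply: eq_Rintegral => t _; rewrite exprMn; congr (_ + _); ring.
rewrite expectD; [|exact: integrable_sub (integrable_constant P 1)|exact: integrable_scale].
rewrite expectB ?expect_constant ?scaled_sqr//; last exact: integrable_constant.
by rewrite /v; congr (_ + _); ring.
Qed.

Let itaylor : intg (fun t => cos (tau * A t) - 1 + (tau * A t) ^+ 2 / 2).
Proof.
have := integrable_add (integrable_sub icos (integrable_constant P 1)) (integrable_scale (tau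
  ^+ 2 / 2) iA2).
by congr (P.-integrable _ (EFin \o _)); apply/funext => t; rewrite exprMn; congr (_ + _); ring.
Qed.

Let sinE : \int[P]_t (sin (tau * A t) - tau * A t) = \int[P]_t sin (tau * A t).
Proof. by rewrite expectB ?expectZ// ?A0 ?mulr0 ?subr0//; exact: integrable_scale. Qed.

Let isinB : intg (fun t => sin (tau * A t) - tau * A t).
Proof. by apply: integrable_sub => //; exact: integrable_scale. Qed.

Lemma onem_expect_cos_le : 1 - \int[P]_t cos (tau * A t) <= v.
Proof.
rewrite -subr_ge0 (_ : _ - _ = \int[P]_t cos (tau * A t) - 1 + v); last by ring.
by rewrite -taylorE; apply: Rintegral_ge0 => t _; exact: cos_taylor_ge0.
Qed.

Lemma norm_expect_sin_le : `|\int[P]_t sin (tau * A t)| <= 2 * v.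
Proof.
rewrite -sinE (_ : 2 * v = \int[P]_t (tau ^+ 2 * A t ^+ 2)).
  apply: norm_expect_le => // [|t]; first exact: integrable_scale.
  by rewrite -exprMn; exact: sin_sub_le_sqr.
by rewrite scaled_sqr /v; field.
Qed.

Let tail_set kappa : measurable [set t | kappa <= `|A t|].
Proof.
rewrite (_ : [set _ | _] = (fun t => `|A t|) @^-1` `[kappa, +oo[).
  have mn : measurable_fun setT (fun t => `|A t|) by apply: measurableT_comp => //; exact: As.1.
  by rewrite -[X in measurable X]setTI; apply: mn.
by apply/seteqP; split => t /=; rewrite in_itv /= andbT.
Qed.

Let itail kappa : intg ((fun t => `|A t| ^+ 2) \_ [set t | kappa <= `|A t|]).
Proof.
apply: (integrable_dominated _ _ iA2) => [|t].
  apply/(measurable_restrictT _ _).1; first exact: tail_set.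
  apply: measurable_funTS; apply: measurable_funX.
  by apply: measurableT_comp => //; exact: As.1.
rewrite patchE; case: ifPn => _; last by rewrite normr0 sqr_ge0.
by rewrite real_normK ?num_real// ger0_norm ?sqr_ge0.
Qed.

(** Split at [|A| = kappa]: above, the quadratic bound gives the tail moment; below,
the cubic bound gains the factor [|tau| * kappa]. *)
Let truncation (g : R -> R) kappa : 0 <= kappa ->
  (forall x, `|g x| <= x ^+ 2) -> (forall x, `|g x| <= `|x| ^+ 3) ->
  intg (fun t => g (tau * A t)) ->
  `|\int[P]_t g (tau * A t)| <= tau ^+ 2 * tail_moment kappa + `|tau| ^+ 3 * kappa * Var P A.
Proof.
move=> k0 g2 g3 ig.
rewrite /tail_moment [X in _ * X + _]Rintegral_mkcond -expectZ// -scaled_sqr -expectD; last 2 first.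
- exact: integrable_scale.
- exact: integrable_scale.
apply: norm_expect_le => // [|t].
  by apply: integrable_add; exact: integrable_scale.
have t3 : 0 <= `|tau| ^+ 3 * kappa by rewrite mulr_ge0// exprn_ge0.
rewrite patchE; case: ifPn => [_|].
  apply: le_trans (g2 _) _; rewrite exprMn real_normK ?num_real// lerDl.
  by rewrite mulr_ge0// sqr_ge0.
rewrite notin_setE /= => /negP; rewrite -ltNge => Ak.
apply: le_trans (g3 _) _; rewrite mulr0 add0r normrM exprMn -[leRHS]mulrA ler_wpM2l ?exprn_ge0//.
by rewrite exprS -(real_normK (num_real (A t))) ler_wpM2r ?exprn_ge0// ltW.
Qed.

Lemma expect_cos_dev kappa : 0 <= kappa ->
  `|\int[P]_t cos (tau * A t) - expR (- v)| <=
  tau ^+ 2 * tail_moment kappa + `|tau| ^+ 3 * kappa * Var P A + v ^+ 2.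
Proof.
move=> k0.
have v0 : 0 <= v by rewrite /v divr_ge0// mulr_ge0 ?sqr_ge0 ?Var_ge0.
rewrite (_ : _ - _ = \int[P]_t (cos (tau * A t) - 1 + (tau * A t) ^+ 2 / 2)
   - (expR (- v) - 1 + v)); last by rewrite taylorE; ring.
apply: le_trans (ler_normB _ _) _; apply: lerD; last exact: expRN_taylor.
apply: (truncation (g := fun x => cos x - 1 + x ^+ 2 / 2)) => // x.
  by rewrite ger0_norm ?cos_taylor_ge0// cos_taylor_le_sqr.
by rewrite ger0_norm ?cos_taylor_ge0// cos_taylor_le_cube.
Qed.

Lemma expect_sin_dev kappa : 0 <= kappa ->
  `|\int[P]_t sin (tau * A t)| <=
  tau ^+ 2 * tail_moment kappa + `|tau| ^+ 3 * kappa * Var P A.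
Proof.
move=> k0; rewrite -sinE.
apply: (truncation (g := fun x => sin x - x)) => // x.
  exact: sin_sub_le_sqr.
exact: sin_sub_le_cube.
Qed.

(** The remainder [cos x - 1 + x ^+ 2 / 2] is nonnegative, and at least
[x ^+ 2 / 2 - 2]. At [x = tau * A], on [kappa <= |A|], the constant 2 is at most
[2 / kappa ^+ 2 * A ^+ 2]. *)
Lemma tail_moment_le kappa : 0 < kappa ->
  (tau ^+ 2 / 2 - 2 / kappa ^+ 2) * tail_moment kappa <=
  v - (1 - \int[P]_t cos (tau * A t)).
Proof.
move=> k0; rewrite (_ : v - _ = \int[P]_t cos (tau * A t) - 1 + v); last by ring.
rewrite -taylorE /tail_moment [X in _ * X <= _]Rintegral_mkcond -expectZ//.
apply: expect_le => // [|t]; first exact: integrable_scale.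
rewrite patchE; case: ifPn => [|_]; last by rewrite mulr0 cos_taylor_ge0.
rewrite inE /= => Ak; rewrite real_normK ?num_real//.
have : kappa ^+ 2 <= A t ^+ 2.
  by rewrite -[leRHS]real_normK ?num_real// lerXn2r ?nnegrE// ltW.
rewrite -(ler_pM2r (_ : 0 < (kappa ^+ 2)^-1)) ?invr_gt0 ?exprn_gt0//.
rewrite divff ?gt_eqF ?exprn_gt0// => h.
have := cos_geN1 (tau * A t).
rewrite mulrBl exprMn; lra.
Qed.

End single_block.

(** The variance of [|A|] is nonnegative. *)
Lemma expect_norm_le d (T : measurableType d) (R : realType) (P : probability T R)
    (A : T -> R) : square_integrable P A ->
  \int[P]_t `|A t| <= Num.sqrt (\int[P]_t (A t ^+ 2)).
Proof.
move=> As.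
have nA : square_integrable P (fun t => `|A t|).
  split; first by apply: measurableT_comp => //; exact: As.1.
  by under eq_fun do rewrite real_normK ?num_real//; exact: As.2.
have := Var_ge0 P (fun t => `|A t|); rewrite Var_cov// /real_covariance.
under eq_Rintegral do rewrite -expr2 real_normK ?num_real//.
rewrite -expr2 subr_ge0 => h.
rewrite -[leLHS]ger0_norm ?Rintegral_ge0// -sqrtr_sqr.
exact: ler_wsqrtr.
Qed.

(** * Lindeberg and Feller for the blocks *)

Section blocks.
Context d (T : measurableType d) (R : realType) (P : probability T R).
Context (X : nat -> {RV P >-> R}) (p l m r : nat -> nat).
Hypothesis X_associated : associated X.
Hypothesis X_centered : forall j, (1 <= j)%N -> 'E_P[X j]%E = 0%E.
Hypothesis X_L2 : forall j, (1 <= j)%N -> (X j : T -> R) \in Lfun P 2%:E.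
Local Notation square_integrable := (square_integrable P).
Local Notation cov := (real_covariance P).

Lemma window_sumD a b c t : (a <= b <= c)%N ->
  window_sum X a c t = window_sum X a b t + window_sum X b c t.
Proof.
move=> /andP[ab bc]; rewrite /window_sum -big_cat_nat//.
Qed.

Lemma window_sum_empty a t : window_sum X a a t = 0.
Proof. by rewrite /window_sum big_geq. Qed.

Lemma square_integrable_window a b : square_integrable (window_sum X a b).
Proof.
apply: square_integrable_sum => i; rewrite mem_index_iota => /andP[ai _].
by apply: Lfun2_square_integrable; apply: X_L2; exact: leq_ltn_trans ai.
Qed.

Lemma expect_window a b : \int[P]_t window_sum X a b t = 0.
Proof.
have E1 i : (1 <= i)%N -> \int[P]_t X i t = 0.
  by move=> i1; have := X_centered i1; rewrite expectation.unlock /Rintegral => ->.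
have i_ i : (1 <= i)%N -> P.-integrable setT (EFin \o X i).
  by move=> i1; apply: square_integrableW; apply: Lfun2_square_integrable; exact: X_L2.
pose F i := if (1 <= i)%N then (X i : T -> R) else fun=> 0.
transitivity (\int[P]_t \sum_(a.+1 <= i < b.+1) F i t).
  apply: eq_Rintegral => t _; apply: eq_big_nat => i /andP[ai _].
  by rewrite /F (leq_ltn_trans _ ai).
rewrite expect_sum => [|i]; last first.
  by rewrite /F; case: ifPn => [/i_//|_]; exact: integrable_constant.
apply: big1 => i _; rewrite /F; case: ifPn => [/E1//|_].
exact: expect_constant.
Qed.

(** Blocks are numbered from 0, so that [block n k] is the increment of [partial n]
between [k] and [k.+1]. *)
Definition block n k := D X p l k.+1 n.
Definition partial n k := window_sum X (p n) (p n + k * l n).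

Lemma sum_blocks (F : nat -> R) n : \sum_(1 <= j < n.+1) F j = \sum_(k < n) F k.+1.
Proof. by rewrite big_add1 /= big_mkord. Qed.

Lemma partialS n k t : partial n k.+1 t = partial n k t + block n k t.
Proof.
rewrite /partial /block /D /= -window_sumD// leq_addr leq_add2l leq_mul2r leqnSn orbT//.
Qed.

Lemma partial0 n t : partial n 0 t = 0.
Proof. by rewrite /partial mul0n addn0 window_sum_empty. Qed.

Lemma square_integrable_block n k : square_integrable (block n k).
Proof. exact: square_integrable_window. Qed.

Lemma square_integrable_partial n k : square_integrable (partial n k).
Proof. exact: square_integrable_window. Qed.

Lemma square_integrable_remainder n : square_integrable (remainder X p l m n).
Proof. exact: square_integrable_window. Qed.

Lemma square_integrable_S' n : square_integrable (S' X p n).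
Proof. exact: square_integrable_window. Qed.

Hypothesis euclid : forall n : nat, (1 <= n)%N -> n = (m n * l n + r n)%N.

Lemma S'_split n t : (1 <= n)%N ->
  S' X p n t = partial n (m n) t + remainder X p l m n t.
Proof.
move=> n1; rewrite /S' /partial /remainder (addnC n) -window_sumD//.
by rewrite leq_addr leq_add2l [X in (_ <= X)%N](euclid n1) leq_addr.
Qed.

Lemma sqr_s' n : s' X p n ^+ 2 = Var P (S' X p n).
Proof. by rewrite sqr_sqrtr// Var_ge0. Qed.

Lemma Var_partial n k : Var P (partial n k) =
  \sum_(i < k) Var P (block n i) + 2 * \sum_(i < k) cov (partial n i) (block n i).
Proof.
elim: k => [|k ih].
  rewrite !big_ord0 mulr0 addr0 Var_cov; last exact: square_integrable_partial.
  rewrite /real_covariance; under eq_Rintegral do rewrite partial0 mulr0.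
  by rewrite expect_constant expect_window mulr0 subr0.
rewrite !big_ord_recr /=.
have -> : partial n k.+1 = fun t => partial n k t + block n k t.
  by apply/funext => t; exact: partialS.
rewrite VarD ?ih; [by ring|exact: square_integrable_partial|exact: square_integrable_block].
Qed.

Lemma monotone_functional_block n k : (1 <= n)%N -> (k < m n)%N ->
  monotone_functional X (p n + n) (block n k).
Proof.
move=> n1 km; apply: monotone_functional_window.
by rewrite leq_add2l [X in (_ <= X)%N](euclid n1) (leq_trans _ (leq_addr _ _))// leq_mul2r km orbT.
Qed.

Lemma monotone_functional_partial n k : (1 <= n)%N -> (k <= m n)%N ->
  monotone_functional X (p n + n) (partial n k).
Proof.
move=> n1 km; apply: monotone_functional_window.
by rewrite leq_add2l [X in (_ <= X)%N](euclid n1) (leq_trans _ (leq_addr _ _))// leq_mul2r km orbT.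
Qed.

(** The variance of the window sum is the sum of the variances of the blocks and of
the remainder, plus twice the covariances; those with the remainder are
nonnegative by association. Dependence between blocks is thus paid for by the
defect of the variance ratio from 1. *)
Lemma sum_cov_le n : (1 <= n)%N ->
  2 * \sum_(k < m n) cov (partial n k) (block n k) <=
  s' X p n ^+ 2 - \sum_(k < m n) Var P (block n k).
Proof.
move=> n1; rewrite sqr_s'.
have -> : S' X p n = fun t => partial n (m n) t + remainder X p l m n t.
  by apply/funext => t; exact: S'_split.
rewrite VarD; [|exact: square_integrable_partial|exact: square_integrable_remainder].
rewrite Var_partial.
have := Var_ge0 P (remainder X p l m n).
have : 0 <= cov (partial n (m n)) (remainder X p l m n).
  apply: (associated_cov_ge0 (N := p n + n) X_associated).
  - exact: monotone_functional_partial.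
  - exact: monotone_functional_window.
  - exact: square_integrable_partial.
  - exact: square_integrable_remainder.
lra.
Qed.

Hypothesis s'_gt0 : forall n : nat, (1 <= n)%N -> 0 < s' X p n.

Definition variance_ratio n : R :=
  (s' X p n ^+ 2)^-1 * (\sum_(1 <= j < (m n).+1) Var P (D X p l j n)).

Definition max_ratio n : R :=
  \big[Num.max/0]_(1 <= j < (m n).+1) ((s' X p n ^+ 2)^-1 * Var P (D X p l j n)).

Definition remainder_ratio n : R :=
  (s' X p n ^+ 2)^-1 * Var P (remainder X p l m n).

Definition lindeberg_sum (eps : R) n : R :=
  (s' X p n ^+ 2)^-1 * (\sum_(1 <= j < (m n).+1)
    \int[P]_(t in [set t : T | eps * tau' X p l m n <= `|D X p l j n t|])
       (`|D X p l j n t| ^+ 2)).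

Lemma variance_ratio_ge0 n : 0 <= variance_ratio n.
Proof.
rewrite /variance_ratio mulr_ge0 ?invr_ge0 ?sqr_ge0// sumr_ge0// => i _; exact: Var_ge0.
Qed.

Lemma block_ratio_le n k : (k < m n)%N ->
  (s' X p n ^+ 2)^-1 * Var P (block n k) <= max_ratio n.
Proof.
move=> km; apply: (@le_bigmax_seq _ _ _ _ _ k.+1) => //.
by rewrite mem_index_iota.
Qed.

Lemma variance_ratioE n : (1 <= n)%N ->
  \sum_(k < m n) Var P (block n k) = s' X p n ^+ 2 * variance_ratio n.
Proof.
move=> n1; rewrite /variance_ratio sum_blocks mulrA divff ?mul1r//.
by rewrite gt_eqF// exprn_gt0// s'_gt0.
Qed.

Lemma lindeberg_sumE eps n : (1 <= n)%N ->
  \sum_(k < m n) tail_moment P (block n k) (eps * tau' X p l m n) = s' X p n ^+ 2 *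
    lindeberg_sum eps n.
Proof.
move=> n1; rewrite /lindeberg_sum sum_blocks mulrA divff ?mul1r//.
by rewrite gt_eqF// exprn_gt0// s'_gt0.
Qed.

Lemma sqr_tau' n : (1 <= n)%N -> tau' X p l m n ^+ 2 = s' X p n ^+ 2 * variance_ratio n.
Proof.
move=> n1; rewrite /tau' sqr_sqrtr; last by apply: sumr_ge0 => i _; exact: sqr_ge0.
rewrite sum_blocks -variance_ratioE//; apply: eq_bigr => k _.
by rewrite /tau'_ sqr_sqrtr// Var_ge0.
Qed.

(** The exponent in the characteristic function of a normal variable with the variance
of [t / s' X p n * block n k]. *)
Definition half_scaled_variance (t : R) n k : R := (t / s' X p n) ^+ 2 * Var P (block n k) / 2.

Lemma half_scaled_variance_ge0 t n k : 0 <= half_scaled_variance t n k.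
Proof. by rewrite divr_ge0// mulr_ge0 ?sqr_ge0 ?Var_ge0. Qed.

Lemma sum_half_scaled_variance t n : (1 <= n)%N ->
  \sum_(k < m n) half_scaled_variance t n k = t ^+ 2 / 2 * variance_ratio n.
Proof.
move=> n1; rewrite /half_scaled_variance -mulr_suml -mulr_sumr variance_ratioE//.
by field; rewrite gt_eqF// s'_gt0.
Qed.

Lemma sum_sqr_half_scaled_variance t n : (1 <= n)%N ->
  \sum_(k < m n) half_scaled_variance t n k ^+ 2 <=
  t ^+ 4 / 4 * (max_ratio n * variance_ratio n).
Proof.
move=> n1; have s0 := s'_gt0 n1.
apply: (@le_trans _ _ (\sum_(k < m n) (t ^+ 2 / 2 * max_ratio n) * half_scaled_variance t n k)).
  apply: ler_sum => k _; rewrite expr2 ler_wpM2r ?half_scaled_variance_ge0//.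
  rewrite (_ : half_scaled_variance _ _ _ = t ^+ 2 / 2 * ((s' X p n ^+ 2)^-1 * Var P (block n k))).
    by rewrite ler_wpM2l ?divr_ge0 ?sqr_ge0// block_ratio_le.
  by rewrite /half_scaled_variance; field; rewrite gt_eqF.
by rewrite -mulr_sumr sum_half_scaled_variance// le_eqVlt; apply/orP; left; apply/eqP; field.
Qed.

(** The cost of replacing the blocks by independent normal variables: dependence,
tails of the blocks, third moments of the blocks cut at [eps * tau'], and the
second-order term of the exponential. *)
Definition replacement_error (t eps : R) n : R :=
  t ^+ 2 * (1 - variance_ratio n) + 2 * t ^+ 2 * lindeberg_sum eps n
  + 2 * `|t| ^+ 3 * eps * (1 + variance_ratio n) * variance_ratio n
  + t ^+ 4 / 4 * (max_ratio n * variance_ratio n).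

Lemma sum_block_errors_le (t eps : R) n : (1 <= n)%N -> 0 < eps ->
  \sum_(k < m n) (2 * (t / s' X p n) ^+ 2 * cov (partial n k) (block n k) +
    (`|\int[P]_w cos (t / s' X p n * block n k w) - expR (- half_scaled_variance t n k)| +
     `|\int[P]_w sin (t / s' X p n * block n k w)|)) <= replacement_error t eps n.
Proof.
move=> n1 e0; have s0 := s'_gt0 n1.
set tau := t / s' X p n; pose kappa := eps * tau' X p l m n.
have k0 : 0 <= kappa by rewrite mulr_ge0 ?(ltW e0)// sqrtr_ge0.
pose bnd k := 2 * tau ^+ 2 * cov (partial n k) (block n k) +
  (2 * (tau ^+ 2 * tail_moment P (block n k) kappa) +
   2 * (`|tau| ^+ 3 * kappa * Var P (block n k)) + half_scaled_variance t n k ^+ 2).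
apply: (@le_trans _ _ (\sum_(k < m n) bnd k)).
  apply: ler_sum => k _; rewrite lerD2l.
  have h1 := expect_cos_dev tau (square_integrable_block n k) (expect_window _ _) k0.
  have h2 := expect_sin_dev tau (square_integrable_block n k) (expect_window _ _) k0.
  by apply: le_trans (lerD h1 h2) _; rewrite -/(half_scaled_variance t n k); lra.
rewrite /bnd !big_split /= -!mulr_sumr lindeberg_sumE// variance_ratioE//.
rewrite /replacement_error -!addrA; apply: lerD.
  rewrite -mulrA mulrCA.
  apply: le_trans (ler_wpM2l (sqr_ge0 tau) (sum_cov_le n1)) _.
  rewrite variance_ratioE// le_eqVlt; apply/orP; left; apply/eqP.
  by rewrite /tau; field; rewrite gt_eqF.
rewrite !addrA; apply: lerD; last exact: sum_sqr_half_scaled_variance.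
apply: lerD.
  by rewrite le_eqVlt; apply/orP; left; apply/eqP; rewrite /tau; field; rewrite gt_eqF.
(* the quotient q satisfies q^2 = variance_ratio n, and q <= 1 + q^2 *)
have q1 : tau' X p l m n / s' X p n <= 1 + variance_ratio n.
  have : (tau' X p l m n / s' X p n) ^+ 2 = variance_ratio n.
    by rewrite expr_div_n sqr_tau'//; field; rewrite gt_eqF.
  have := sqr_ge0 (tau' X p l m n / s' X p n - 1).
  have := variance_ratio_ge0 n.
  nra.
rewrite [leLHS](_ : _ = 2 * `|t| ^+ 3 * eps * (tau' X p l m n / s' X p n) * variance_ratio
  n); last first.
  by rewrite /tau /kappa normrM normfV (gtr0_norm s0); field; rewrite gt_eqF.
rewrite ler_wpM2r ?variance_ratio_ge0// ler_wpM2l//.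
by rewrite !mulr_ge0 ?exprn_ge0// ltW.
Qed.

Lemma expect_cos_partial t eps n : (1 <= n)%N -> 0 < eps ->
  `|\int[P]_w cos (t / s' X p n * partial n (m n) w) -
    expR (- (t ^+ 2 / 2 * variance_ratio n))| <= replacement_error t eps n.
Proof.
move=> n1 e0; rewrite -sum_half_scaled_variance//.
apply: le_trans (sum_block_errors_le t n1 e0).
apply: (@expect_cos_sum _ _ _ _ _ X_associated (p n + n)).
- exact: partial0.
- by move=> k w; exact: partialS.
- by move=> k km; apply: monotone_functional_partial => //; exact: ltnW.
- by move=> k km; exact: monotone_functional_block.
- exact: square_integrable_partial.
- exact: square_integrable_block.
- exact: half_scaled_variance_ge0.
Qed.

Lemma expect_sin_partial t eps n : (1 <= n)%N -> 0 < eps ->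
  `|\int[P]_w sin (t / s' X p n * partial n (m n) w)| <= replacement_error t eps n.
Proof.
move=> n1 e0.
apply: le_trans (sum_block_errors_le t n1 e0).
apply: (@expect_sin_sum _ _ _ _ _ X_associated (p n + n)).
- exact: partial0.
- by move=> k w; exact: partialS.
- by move=> k km; apply: monotone_functional_partial => //; exact: ltnW.
- by move=> k km; exact: monotone_functional_block.
- exact: square_integrable_partial.
- exact: square_integrable_block.
- exact: half_scaled_variance_ge0.
Qed.

Lemma expect_modulus_partial t n : (1 <= n)%N ->
  `|(\int[P]_w cos (t / s' X p n * partial n (m n) w)) ^+ 2 +
    (\int[P]_w sin (t / s' X p n * partial n (m n) w)) ^+ 2 -
    expR (- (2 * \sum_(k < m n) (1 - \int[P]_w cos (t / s' X p n * block n k w))))|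
  <= 6 * t ^+ 2 * (1 - variance_ratio n) +
     18 * (t ^+ 4 / 4 * (max_ratio n * variance_ratio n)).
Proof.
move=> n1; have s0 := s'_gt0 n1.
have := @expect_modulus_sum _ _ _ _ _ X_associated (p n + n) (m n) (partial n)
  (block n) (t / s' X p n) (partial0 n) (partialS n)
  (fun k km => monotone_functional_partial n1 (ltnW km))
  (fun k km => monotone_functional_block n1 km)
  (square_integrable_partial n) (square_integrable_block n) (half_scaled_variance t n).
move=> /(_ _ _)/le_trans; apply.
- by move=> k; exact: onem_expect_cos_le (square_integrable_block n k) (expect_window _ _).
- by move=> k; apply: norm_expect_sin_le (square_integrable_block n k) (expect_window _ _).
rewrite big_split /= -!mulr_sumr; apply: lerD; last first.
  by rewrite ler_wpM2l// sum_sqr_half_scaled_variance.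
rewrite (_ : 12 * _ * _ = 6 * (t / s' X p n) ^+ 2 * (2 * \sum_(k < m n) cov (partial n k)
  (block n k))); last by ring.
apply: le_trans (ler_wpM2l _ (sum_cov_le n1)) _; first by rewrite mulr_ge0// sqr_ge0.
rewrite variance_ratioE// le_eqVlt; apply/orP; left; apply/eqP.
by field; rewrite gt_eqF.
Qed.

(** Feller's estimate [tail_moment_le], summed over the blocks at
[kappa = eps * tau']. The lower bound on the variance ratio keeps [tau'] comparable
with [s']. *)
Lemma lindeberg_sum_le t eps n : (1 <= n)%N -> 0 < eps -> 2^-1 <= variance_ratio n ->
  (t ^+ 2 / 2 - 4 / eps ^+ 2) * lindeberg_sum eps n <=
  t ^+ 2 / 2 * variance_ratio n -
  \sum_(k < m n) (1 - \int[P]_w cos (t / s' X p n * block n k w)).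
Proof.
move=> n1 e0 v2; have s0 := s'_gt0 n1.
have v0 : 0 < variance_ratio n by apply: lt_le_trans v2.
pose kappa := eps * tau' X p l m n.
have tau0 : 0 < tau' X p l m n.
  by rewrite lt_neqAle sqrtr_ge0 andbT eq_sym -sqrf_eq0 sqr_tau'// gt_eqF// mulr_gt0// exprn_gt0.
have k0 : 0 < kappa by rewrite mulr_gt0.
rewrite -sum_half_scaled_variance// -sumrB.
apply: (@le_trans _ _ (\sum_(k < m n) ((t / s' X p n) ^+ 2 / 2 - 2 / kappa ^+ 2) *
  tail_moment P (block n k) kappa)).
  rewrite -mulr_sumr lindeberg_sumE// [leRHS]mulrA ler_wpM2r//.
    rewrite /lindeberg_sum mulr_ge0 ?invr_ge0 ?sqr_ge0// sumr_ge0// => j _.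
    by apply: Rintegral_ge0 => w _; exact: exprn_ge0.
  rewrite /kappa [(eps * _) ^+ 2]exprMn sqr_tau'//.
  rewrite (_ : _ * s' X p n ^+ 2 = t ^+ 2 / 2 - (2 / eps ^+ 2) * (variance_ratio n)^-1); last first.
    by field; rewrite !gt_eqF.
  rewrite lerD2l lerN2 (_ : 4 / eps ^+ 2 = 2 / eps ^+ 2 * 2); last by ring.
  rewrite ler_wpM2l ?divr_ge0 ?sqr_ge0//.
  by rewrite -[leRHS]invrK lef_pV2 ?posrE.
apply: ler_sum => k _.
exact: (tail_moment_le (t / s' X p n) (square_integrable_block n k) (expect_window _ _)).
Qed.

Lemma expect_remainder_le (f : R -> R) t n : (1 <= n)%N ->
  continuous f -> (exists M : R, forall x, `|f x| <= M) -> (forall x y, `|f y - f x| <= `|y - x|) ->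
  `|\int[P]_w f (t * (S' X p n w / s' X p n)) -
    \int[P]_w f (t / s' X p n * partial n (m n) w)| <=
  `|t| * Num.sqrt (remainder_ratio n).
Proof.
move=> n1 cf [M fM] flip; have s0 := s'_gt0 n1.
have mf : measurable_fun setT f by exact: continuous_measurable_fun.
have rs := square_integrable_remainder n.
have iZ : P.-integrable setT (EFin \o (fun w => `|remainder X p l m n w|)).
  by apply: integrable_norm; exact: square_integrableW.
apply: (@le_trans _ _ (\int[P]_w (`|t| / s' X p n * `|remainder X p l m n w|))).
  apply: expect_dist_le.
  - apply: (@integrable_bounded _ _ _ _ _ M) => //.
    apply: (measurableT_comp mf); apply: measurable_funM => //; apply: measurable_funM => //.
    exact: (square_integrable_S' n).1.
  - apply: (@integrable_bounded _ _ _ _ _ M) => //.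
    apply: (measurableT_comp mf); apply: measurable_funM => //.
    exact: (square_integrable_partial n (m n)).1.
  - exact: integrable_scale.
  - move=> w; apply: le_trans (flip _ _) _.
    rewrite S'_split// (_ : _ - _ = t / s' X p n * remainder X p l m n w).
      by rewrite !normrM normfV (gtr0_norm s0).
    by ring.
rewrite expectZ// -mulrA ler_wpM2l//.
rewrite /remainder_ratio sqrtrM ?invr_ge0 ?sqr_ge0// sqrtrV ?sqr_ge0// sqrtr_sqr (gtr0_norm s0).
rewrite ler_wpM2l ?invr_ge0 ?(ltW s0)//.
by rewrite (Var_centered rs (expect_window _ _)); exact: expect_norm_le.
Qed.

Hypothesis Ha : variance_ratio n @[n --> \oo] --> (1 : R).
Hypothesis Hab : remainder_ratio n @[n --> \oo] --> (0 : R).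
Hypothesis Hb : max_ratio n @[n --> \oo] --> (0 : R).

(** The square of [B n] is at most [max_ratio n / variance_ratio n]. *)
Lemma B_cvg0 : B X p l m n @[n --> \oo] --> (0 : R).
Proof.
have lim : Num.sqrt (max_ratio n / variance_ratio n) @[n --> \oo] --> (0 : R).
  rewrite -sqrtr0; apply: (continuous_cvg _ (@sqrt_continuous R 0)).
  rewrite -[X in _ --> X](mul0r (1 : R)^-1); apply: cvgM => //; apply: cvgV => //.
apply: (squeeze_cvgr _ (@cvg_cst _ _ _ _ _) lim).
near=> n.
have n1 : (1 <= n)%N by near: n; exact: nbhs_infty_ge.
have s0 := s'_gt0 n1.
have v0 : 0 < variance_ratio n by near: n; exact: (cvgr_gt 1 Ha).
rewrite bigmax_ge_id /= /B big_seq; apply: bigmax_le => [|j]; first exact: sqrtr_ge0.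
rewrite mem_index_iota => /andP[j1 jm].
rewrite /tau'_ -[tau' _ _ _ _ _](ger0_norm (sqrtr_ge0 _)) -sqrtr_sqr -sqrtrV ?sqr_ge0//.
rewrite -sqrtrM ?Var_ge0//; apply: ler_wsqrtr.
rewrite sqr_tau'// invfM mulrA ler_wpM2r ?invr_ge0 ?(ltW v0)// mulrC.
by rewrite -[j](prednK j1); apply: block_ratio_le; rewrite prednK.
Unshelve. all: end_near. Qed.

(** The cut-off [eps] is chosen first: once the variance ratio is at most 2, the third
term is at most [12 * `|t| ^+ 3 * eps]. The other terms tend to zero for fixed
[eps]. *)
Lemma replacement_error_small t e : (forall eps : R, 0 < eps ->
  lindeberg_sum eps n @[n --> \oo] --> (0 : R)) ->
  0 < e -> exists2 eps, 0 < eps & \forall n \near \oo, replacement_error t eps n <= e.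
Proof.
move=> HL e0.
pose c := 12 * `|t| ^+ 3 + 1.
have c0 : 0 < c by rewrite ltr_wpDl// mulr_ge0// exprn_ge0.
have e20 : 0 < e / 2 by rewrite divr_gt0.
exists (e / 2 / c); first by rewrite divr_gt0.
set eps := e / 2 / c; have eps0 : 0 < eps by rewrite divr_gt0.
pose small n := t ^+ 2 * (1 - variance_ratio n) + 2 * t ^+ 2 * lindeberg_sum eps n
  + t ^+ 4 / 4 * (max_ratio n * variance_ratio n).
have small0 : small n @[n --> \oo] --> (0 : R).
  have -> : 0 = t ^+ 2 * (1 - 1) + 2 * t ^+ 2 * 0 + t ^+ 4 / 4 * (0 * 1) :> R by ring.
  apply: cvgD; first apply: cvgD; apply: cvgMr.
  - by apply: cvgB => //; exact: cvg_cst.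
  - exact: HL.
  - exact: cvgM.
near=> n.
have sn : small n <= e / 2 by near: n; exact: (cvgr_le 0 small0).
have v2 : variance_ratio n <= 2 by near: n; apply: (cvgr_le 1 Ha); rewrite ltr1n.
rewrite (_ : replacement_error _ _ _ = small n + 2 * `|t| ^+ 3 * eps * ((1 +
  variance_ratio n) * variance_ratio n)); last first.
  by rewrite /replacement_error /small; ring.
rewrite [leRHS]splitr lerD//.
have v0 := variance_ratio_ge0 n.
have t0 : 0 <= 2 * `|t| ^+ 3 * eps by apply: mulr_ge0; [rewrite mulr_ge0// exprn_ge0|exact: ltW].
apply: (@le_trans _ _ (2 * `|t| ^+ 3 * eps * 6)).
  by rewrite ler_wpM2l//; nra.
rewrite (_ : 2 * _ * _ * 6 = 12 * `|t| ^+ 3 * eps); last by ring.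
rewrite -[leRHS](divfK (lt0r_neq0 c0)) -/eps mulrC ler_wpM2l ?(ltW eps0)//.
by rewrite lerDl.
Unshelve. all: end_near. Qed.

Lemma remainder_negligible (f : R -> R) t : continuous f ->
  (exists M : R, forall x, `|f x| <= M) -> (forall x y, `|f y - f x| <= `|y - x|) ->
  (\int[P]_w f (t * (S' X p n w / s' X p n)) -
   \int[P]_w f (t / s' X p n * partial n (m n) w)) @[n --> \oo] --> (0 : R).
Proof.
move=> cf bf lf.
have lim : `|t| * Num.sqrt (remainder_ratio n) @[n --> \oo] --> (0 : R).
  rewrite -[X in _ --> X](mulr0 `|t|); apply: cvgMr.
  by rewrite -sqrtr0; apply: (continuous_cvg _ (@sqrt_continuous R 0)).
apply/cvgr0Pnorm_le => e e0.
have /cvgr0Pnorm_le /(_ _ e0) := lim.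
apply: filterS2 (nbhs_infty_gt 0) => n n1 hn.
apply: le_trans (expect_remainder_le t n1 cf bf lf) _.
by rewrite (le_trans _ hn)// ler_norm.
Qed.

Lemma lindeberg_cos t : (forall eps : R, 0 < eps -> lindeberg_sum eps n @[n --> \oo] --> (0 : R)) ->
  \int[P]_w cos (t * (S' X p n w / s' X p n)) @[n --> \oo] --> expR (- (t ^+ 2 / 2)).
Proof.
move=> HL.
have h1 := remainder_negligible t (@continuous_cos R) (ex_intro _ 1 (@cos_max R))
  (@cos_lipschitz R).
have h2 : expR (- (t ^+ 2 / 2 * variance_ratio n)) @[n --> \oo] --> expR (- (t ^+ 2 / 2)).
  rewrite -[X in _ --> expR (- X)]mulr1; apply: continuous_cvg; first exact: continuous_expR.
  by apply: cvgN; apply: cvgMr.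
have h3 : (\int[P]_w cos (t / s' X p n * partial n (m n) w) -
    expR (- (t ^+ 2 / 2 * variance_ratio n))) @[n --> \oo] --> (0 : R).
  apply/cvgr0Pnorm_le => e e0.
  have [eps eps0] := replacement_error_small t HL e0.
  apply: filterS2 (nbhs_infty_gt 0) => n n1 hn.
  exact: le_trans (expect_cos_partial t n1 eps0) hn.
have := cvg_seqD (cvg_seqD h1 h3) h2; rewrite !add0r.
by apply: eq_cvg_seq => n /=; ring.
Qed.

Lemma lindeberg_sin t : (forall eps : R, 0 < eps -> lindeberg_sum eps n @[n --> \oo] --> (0 : R)) ->
  \int[P]_w sin (t * (S' X p n w / s' X p n)) @[n --> \oo] --> (0 : R).
Proof.
move=> HL.
have h1 := remainder_negligible t (@continuous_sin R) (ex_intro _ 1 (@sin_max R))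
  (@sin_lipschitz R).
have h3 : \int[P]_w sin (t / s' X p n * partial n (m n) w) @[n --> \oo] --> (0 : R).
  apply/cvgr0Pnorm_le => e e0.
  have [eps eps0] := replacement_error_small t HL e0.
  apply: filterS2 (nbhs_infty_gt 0) => n n1 hn.
  exact: le_trans (expect_sin_partial t n1 eps0) hn.
have := cvg_seqD h1 h3; rewrite !add0r.
by apply: eq_cvg_seq => n /=; ring.
Qed.

Lemma normalized_sqr_integrable n :
  P.-integrable setT (EFin \o (fun w => (S' X p n w / s' X p n) ^+ 2)).
Proof.
under eq_fun do rewrite mulrC.
exact: (square_integrable_scale _ (square_integrable_S' n)).2.
Qed.

Lemma normalized_sqr_le1 n : \int[P]_w ((S' X p n w / s' X p n) ^+ 2) <= 1.
Proof.
under eq_Rintegral do rewrite mulrC exprMn.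
rewrite expectZ; last exact: (square_integrable_S' n).2.
rewrite -Var_centered; [|exact: square_integrable_S'|exact: expect_window].
rewrite -sqr_s' -exprMn.
have [->|s0] := eqVneq (s' X p n) 0; first by rewrite mulr0 expr0n.
by rewrite mulVf// expr1n.
Qed.

Lemma lindeberg_clt : (forall eps : R, 0 < eps -> lindeberg_sum eps n @[n --> \oo] --> (0 : R)) ->
  cvg_in_distribution P (fun n t => S' X p n t / s' X p n)
    (normal_prob (0 : R) 1 : probability (measurableTypeR R) R).
Proof.
move=> HL.
(* the second moments under P are at most 1, see normalized_sqr_le1 *)
apply: (@levy_continuity _ _ _ _ _ _ _ _ _ _ _ (Num.max 1 (\int[normal_prob (0 : R) 1]_x (x
  ^+ 2)))).
- move=> n; apply: measurable_funM => //; exact: (square_integrable_S' n).1.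
- by move=> t; rewrite normal_cos; exact: lindeberg_cos.
- by move=> t; rewrite normal_sin; exact: lindeberg_sin.
- exact: normalized_sqr_integrable.
- exact: normal_sqr_integrable.
- by move=> n; rewrite le_max normalized_sqr_le1.
- by rewrite le_max lexx orbT.
Qed.

Lemma clt_expect (f : R -> R) : continuous f -> (exists M : R, forall x, `|f x| <= M) ->
  cvg_in_distribution P (fun n t => S' X p n t / s' X p n)
    (normal_prob (0 : R) 1 : probability (measurableTypeR R) R) ->
  \int[P]_w f (S' X p n w / s' X p n) @[n --> \oo] --> \int[normal_prob (0 : R) 1]_x f x.
Proof.
move=> cf [M fM] /(_ f cf).
have mf : measurable_fun setT f by exact: continuous_measurable_fun.
have bf : bounded_fun f.
  by exists M; split; [exact: num_real|move=> N MN x _; exact: le_trans (fM x) (ltW MN)].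
move=> /(_ bf) h; rewrite /Rintegral; apply: fine_cvg; rewrite fineK.
  by move: h; rewrite expectation.unlock.
apply: integrable_fin_num => //.
exact: (@integrable_bounded _ _ _ (normal_prob (0 : R) 1 : probability (measurableTypeR R) R) f M).
Qed.

(** The limit of the squared modulus of the characteristic function gives that of the
sum [a n] of [1 - E cos] over the blocks, and [lindeberg_sum_le] turns it into the
Lindeberg condition. The value of [t] makes [t ^+ 2 / 2 - 4 / eps ^+ 2] equal
to 1. *)
Lemma clt_lindeberg : cvg_in_distribution P (fun n t => S' X p n t / s' X p n)
    (normal_prob (0 : R) 1 : probability (measurableTypeR R) R) ->
  forall eps : R, 0 < eps -> lindeberg_sum eps n @[n --> \oo] --> (0 : R).
Proof.
move=> clt eps eps0.
pose t : R := Num.sqrt (2 * (4 / eps ^+ 2 + 1)).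
have t2 : t ^+ 2 / 2 = 4 / eps ^+ 2 + 1.
  by rewrite sqr_sqrtr ?mulr_ge0 ?addr_ge0 ?divr_ge0 ?sqr_ge0//; field; rewrite gt_eqF.
have lipt (f : R -> R) : continuous f -> continuous (fun x => f (t * x)).
  move=> cf x; apply: continuous_comp; last exact: cf.
  by apply: continuousM; [exact: cst_continuous|exact: cvg_id].
have bc : exists M : R, forall x, `|cos (t * x)| <= M by exists 1 => x; exact: cos_max.
have bs : exists M : R, forall x, `|sin (t * x)| <= M by exists 1 => x; exact: sin_max.
have hc := clt_expect (lipt _ (@continuous_cos R)) bc clt.
have hs := clt_expect (lipt _ (@continuous_sin R)) bs clt.
rewrite normal_cos in hc; rewrite normal_sin in hs.
have rc := remainder_negligible t (@continuous_cos R) (ex_intro _ 1 (@cos_max R))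
  (@cos_lipschitz R).
have rs := remainder_negligible t (@continuous_sin R) (ex_intro _ 1 (@sin_max R))
  (@sin_lipschitz R).
pose x n := \int[P]_w cos (t / s' X p n * partial n (m n) w).
pose y n := \int[P]_w sin (t / s' X p n * partial n (m n) w).
have xc : x n @[n --> \oo] --> expR (- (t ^+ 2 / 2)).
  have := cvg_seqB hc rc; rewrite subr0.
  by apply: eq_cvg_seq => n; rewrite /x /=; ring.
have yc : y n @[n --> \oo] --> (0 : R).
  have := cvg_seqB hs rs; rewrite subr0.
  by apply: eq_cvg_seq => n; rewrite /y /=; ring.
pose a n := \sum_(k < m n) (1 - \int[P]_w cos (t / s' X p n * block n k w)).
have err : (x n ^+ 2 + y n ^+ 2 - expR (- (2 * a n))) @[n --> \oo] --> (0 : R).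
  have lim : 6 * t ^+ 2 * (1 - variance_ratio n) +
     18 * (t ^+ 4 / 4 * (max_ratio n * variance_ratio n)) @[n --> \oo] --> (0 : R).
    have -> : 0 = 6 * t ^+ 2 * (1 - 1) + 18 * (t ^+ 4 / 4 * (0 * 1)) :> R by ring.
    apply: cvgD; apply: cvgMr.
      by apply: cvgB => //; exact: cvg_cst.
    by apply: cvgMr; exact: cvgM.
  apply/cvgr0Pnorm_le => e e0.
  have /cvgr0Pnorm_le /(_ _ e0) := lim.
  apply: filterS2 (nbhs_infty_gt 0) => n n1 hn.
  apply: le_trans (expect_modulus_partial t n1) _.
  by rewrite (le_trans _ hn)// ler_norm.
have expc : expR (- (2 * a n)) @[n --> \oo] --> expR (- t ^+ 2).
  have := cvg_seqB (cvg_seqD (cvg_seqM xc xc) (cvg_seqM yc yc)) err.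
  rewrite mulr0 addr0 subr0 -expRD (_ : - (t ^+ 2 / 2) + - (t ^+ 2 / 2) = - t ^+ 2); last by field.
  by apply: eq_cvg_seq => n /=; ring.
have ac : a n @[n --> \oo] --> t ^+ 2 / 2.
  have lnc : ln (expR (- (2 * a n))) @[n --> \oo] --> ln (expR (- t ^+ 2)).
    by apply: continuous_cvg expc; apply: continuous_ln; exact: expR_gt0.
  have -> : t ^+ 2 / 2 = - 2^-1 * ln (expR (- t ^+ 2)) by rewrite expRK; ring.
  have cst : (fun=> - 2^-1 : R) n @[n --> \oo] --> (- 2^-1 : R) by exact: cvg_cst.
  have := cvg_seqM cst lnc.
  by apply: eq_cvg_seq => n /=; rewrite expRK; field.
have lim : t ^+ 2 / 2 * variance_ratio n - a n @[n --> \oo] --> (0 : R).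
  have -> : 0 = t ^+ 2 / 2 * 1 - t ^+ 2 / 2 :> R by ring.
  by apply: cvgB => //; apply: cvgMr.
apply: (squeeze_cvgr _ (@cvg_cst _ _ _ _ _) lim).
near=> n.
have n1 : (1 <= n)%N by near: n; exact: nbhs_infty_ge.
have v2 : 2^-1 <= variance_ratio n by near: n; apply: (cvgr_ge 1 Ha); rewrite invf_lt1// ltr1n.
have := lindeberg_sum_le t n1 eps0 v2.
rewrite t2 addrAC subrr add0r mul1r => ->; rewrite andbT.
rewrite /lindeberg_sum mulr_ge0 ?invr_ge0 ?sqr_ge0// sumr_ge0// => j _.
by apply: Rintegral_ge0 => w _; exact: exprn_ge0.
Unshelve. all: end_near. Qed.

End blocks.

Theorem theorem5 (d : measure_display) (T : measurableType d) (R : realType)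
    (P : probability T R) (X : nat -> {RV P >-> R}) (p l m r : nat -> nat)
    (X_associated : associated X)
    (X_centered : forall j : nat, (1 <= j)%N -> 'E_P[X j]%E = 0%E)
    (X_L2 : forall j : nat, (1 <= j)%N -> (X j : T -> R) \in Lfun P 2%:E)
    (s'_gt0 : forall n : nat, (1 <= n)%N -> 0 < s' X p n)
    (l_ge1 : forall n : nat, (1 <= n)%N -> (1 <= l n)%N)
    (euclid : forall n : nat, (1 <= n)%N -> n = (m n * l n + r n)%N)
    (r_lt_l : forall n : nat, (1 <= n)%N -> (r n < l n)%N)
    (m_infty : m n @[n --> \oo] --> \oo)
    (L : (l n)%:R / n%:R @[n --> \oo] --> (0 : R))
    (H0 : (l n)%:R / s' X p n ^+ 2 @[n --> \oo] --> (0 : R))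
    (Ha : (s' X p n ^+ 2)^-1 * (\sum_(1 <= j < (m n).+1) Var P (D X p l j n))
            @[n --> \oo] --> (1 : R))
    (Hab : (s' X p n ^+ 2)^-1 * Var P (remainder X p l m n)
             @[n --> \oo] --> (0 : R))
    (Hb : \big[Num.max/0]_(1 <= j < (m n).+1)
              ((s' X p n ^+ 2)^-1 * Var P (D X p l j n))
            @[n --> \oo] --> (0 : R)) :
  (cvg_in_distribution P (fun n t => S' X p n t / s' X p n)
     (normal_prob (0 : R) 1 : probability (measurableTypeR R) R) /\
   B X p l m n @[n --> \oo] --> (0 : R))
  <->
  (forall eps : R, 0 < eps ->
     (s' X p n ^+ 2)^-1 * (\sum_(1 <= j < (m n).+1)
        \int[P]_(t in [set t : T | eps * tau' X p l m n <= `|D X p l j n t|])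
           (`|D X p l j n t| ^+ 2))
       @[n --> \oo] --> (0 : R)).
Proof.
split=> [[clt _]|lindeberg_cond].
  exact: (clt_lindeberg X_associated X_centered X_L2 euclid s'_gt0 Ha Hab Hb clt).
split; last exact: (B_cvg0 s'_gt0 Ha Hb).
exact: (lindeberg_clt X_associated X_centered X_L2 euclid s'_gt0 Ha Hab Hb lindeberg_cond).
Qed.
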